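(* Assume the standing hypotheses on the continuous problem and on the space discretization listed in the context. Assume also that $u\in C([0,T],Z)$ and $\partial u\equiv 0$ (i.e. $g\equiv 0$). Then the local error of the classical Lawson full discretization satisfies $$\rho_{h,n+1}=\bar U_h^{n+1}-P_h u(t_{n+1})=O(k),$$ where the constant in the Landau notation is independent of $k$ and $h$. Moreover, if $\sum_{i=1}^s b_i=1$ and $u\in C^2([0,T],X)$, then $$A_{h,0}^{-1}\rho_{h,n+1}=O(\eta_h k+k^2).$$
   Context: **Continuous problem.** $\Omega\subset\mathbb R^d$ is a bounded domain, $X=C(\overline\Omega)$ with the maximum norm, $Y$ is a Banach space, $A:D(A)\subset X\to X$ and $\partial:D(A)\to Y$ are linear. $u$ is the solution of $u'(t)=Au(t)+f(t,u(t))$, $0\le t\le T$, $u(0)=u_0\in X$, $\partial u(t)=g(t)\in Y$, with $f:[0,T]\times X\to X$ (in general nonlinear) and $g:[0,T]\to Y$. *Standing hypotheses on the continuous problem:* (i) $\partial:D(A)\to Y$ is onto and $g\in C^1([0,T],Y)$. (ii) $\ker\partial$ is dense in $X$ and $A_0$, the restriction of $A$ to $D(A_0)=\ker\partial$, generates a $C_0$-semigroup $\{e^{tA_0}\}_{t\ge0}$ on $X$ of negative type $\omega$. (iii) For $\Re z>0$ and $v\in Y$ the problem $Ax=zx$, $\partial x=v$ has a unique solution $x=K(z)v$, and $\|K(z)v\|\le C\|v\|$ with $C$ uniform for $\Re z\ge\omega_0>\omega$. (iv) $f\in C^1([0,T]\times X,X)$. (v) $u\in C^1([0,T],X)$, $u(t)\in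 D(A)$ for all $t\in[0,T]$, $Au\in C([0,T],X)$. **Space discretization.** For a mesh parameter $h$, $\Omega_h$ is a grid with $N$ nodes; $\|\cdot\|_h$ is the maximum norm on $\mathbb C^N$ (and the induced operator norms); $P_h:X\to\mathbb C^N$ maps a function to its values on the grid; $A_{h,0}$ is an $N\times N$ matrix (discretizing $A_0$) and $C_h:Y\to\mathbb C^N$ is linear, so that $A$ acting on functions with $\partial u=g$ is discretized by $A_{h,0}U_h+C_hg$. The function $f$ also makes sense as a map $[0,T]\times\mathbb C^N\to\mathbb C^N$ and $P_hf(t,u)=f(t,P_hu)$ for $t\in[0,T]$, $u\in X$. *Standing hypotheses on the discretization:* (a) $\|e^{tA_{h,0}}\|_h\le1$ for $t\ge0$; $A_{h,0}$ is invertible and $\|A_{h,0}^{-1}\|_h\le C$ with $C$ independent of $h$. (b) Let $R_h:D(A)\to\mathbb C^N$ be defined by $A_{h,0}R_hu+C_h\partial u=P_hAu$. There is a subspace $Z\subset D(A)$ with norm $\|\cdot\|_Z$ such that for $u\in Z$: $A_0^{-1}u\in Z$ and $e^{tA_0}u,f(t,u)\in Z$ for $t\in[0,T]$; $\|A_{h,0}(P_hu-R_hu)\|_h\le\varepsilon_h\|u\|_Z$ and $\|P_hu-R_hu\|_h\le\eta_h\|u\|_Z$, with $\varepsilon_h,\eta_h$ small with $h$. Moreover $\|A_{h,0}^{-1}C_h\|_h\le C''$ with $C''$ independent of $h$. (c) $f\in C^1([0,T]\times\mathbb C^N,\mathbb C^N)$ and its derivative with respect to the variable in $\mathbb C^N$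 is uniformly bounded in a neighbourhood of the solution where the numerical approximation stays. **Classical Lawson discretization (first space, then time).** Let $a_{ij}$ ($j<i$), $b_i$, $c_i$ ($1\le i\le s$) be the coefficients of an explicit Runge–Kutta tableau. Let $k>0$ be the time stepsize, $t_n=nk$, with $t_{n+1}\le T$. The scheme is applied with one step starting from $P_hu(t_n)$: for $i=1,\dots,s$, $$\bar K_{h,i}^n=e^{c_ikA_{h,0}}P_hu(t_n)+k\sum_{j=1}^{i-1}a_{ij}e^{(c_i-c_j)kA_{h,0}}[C_hg(t_n+c_jk)+f(t_n+c_jk,\bar K^n_{h,j})],$$ $$\bar U_h^{n+1}=e^{kA_{h,0}}P_hu(t_n)+k\sum_{i=1}^sb_ie^{(1-c_i)kA_{h,0}}[C_hg(t_n+c_ik)+f(t_n+c_ik,\bar K_{h,i}^n)].$$ The local error is $\rho_{h,n+1}=\bar U_h^{n+1}-P_hu(t_{n+1})$. All $O(\cdot)$ bounds are in $\|\cdot\|_h$.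
   Formalization: The tableau is assumed to satisfy 0 ≤ c_i ≤ 1, and c_j ≤ c_i whenever j < i and a_ij ≠ 0; without this ordering the exponentials e^{(c_i-c_j)kA_{h,0}} run backward in time and the bounds uniform in h fail. *)

(* Defs.v *)
From HB Require Import structures.
From mathcomp Require Import all_boot all_order all_algebra.
From mathcomp Require Import all_classical all_reals all_analysis.
From mathcomp Require Import complex.

Set Implicit Arguments.
Unset Strict Implicit.
Unset Printing Implicit Defensive.

Import Order.TTheory GRing.Theory Num.Theory.
Import numFieldNormedType.Exports.

Local Open Scope classical_set_scope.
Local Open Scope ring_scope.
Local Open Scope complex_scope.

(* Norms of a normedModType R[i] live in R[i]; cnorm is the real number. *)
Definition cnorm (R : realType) (V : normedZmodType R[i]) (x : V) : R :=
  complex.Re `|x|.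

Section CnormTheory.
Context (R : realType) (V : normedZmodType R[i]).
Implicit Types x y : V.

Lemma cnormE x : (cnorm x)%:C = `|x|.
Proof.
rewrite /cnorm; have := normr_ge0 x; case: `|x| => a b.
by rewrite lecE => /andP[/eqP/= -> _].
Qed.

Lemma cnorm_ge0 x : 0 <= cnorm x.
Proof. by rewrite -lecR cnormE normr_ge0. Qed.

Lemma cnorm_eq0 x : cnorm x = 0 -> x = 0.
Proof. by move=> x0; apply/normr0_eq0; rewrite -cnormE x0. Qed.

Lemma cnorm0 : cnorm (0 : V) = 0.
Proof. by rewrite /cnorm normr0. Qed.

Lemma cnormD x y : cnorm (x + y) <= cnorm x + cnorm y.
Proof. by rewrite -lecR rmorphD/= !cnormE ler_normD. Qed.

End CnormTheory.

Lemma cnorm_continuous (R : realType) (V : normedModType R[i]) :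
  continuous (@cnorm R V).
Proof.
move=> x; apply/cvgrPdist_lt => e e0.
have e0C : 0 < e%:C by rewrite ltcR.
near=> y.
have xy : cnorm (x - y) < e.
  by rewrite -ltcR cnormE; near: y; exact: (@cvgr_dist_lt _ _ _ (nbhs x) _ id x (@cvg_id _ (nbhs x)) _ e0C).
apply: le_lt_trans xy; rewrite ler_norml lerNl opprB !lerBlDr.
have yx : cnorm (y - x) = cnorm (x - y) by rewrite /cnorm distrC.
apply/andP; split; first by have := cnormD (y - x) x; rewrite subrK yx.
by have := cnormD (x - y) y; rewrite subrK.
Unshelve. all: by end_near. Qed.

Lemma cnormM (R : realType) (a b : R[i]) :
  cnorm (a * b) = cnorm a * cnorm b.
Proof.
by apply: (@complexI R); rewrite rmorphM/= !cnormE normrM.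
Qed.

(* Operator norm induced by the norms of V and W, possibly +oo. *)
Definition opnorm (R : realType) (V W : normedZmodType R[i]) (B : V -> W) :
    \bar R :=
  ereal_sup [set (cnorm (B v))%:E | v in [set v | cnorm v <= 1]].

Record bounded_domain (R : realType) (d : nat) := BoundedDomain {
  domain_set :> set 'rV[R]_d;
  domain_open : open domain_set;
  domain_connected : connected domain_set;
  domain_nonempty : domain_set !=set0;
  domain_bounded : bounded_set domain_set }.

Section ContFun.
Context (R : realType) (d : nat) (Omega : bounded_domain R d).

Definition cont_on_closure : {pred 'rV[R]_d -> R[i]^o} :=
  [pred f | `[< {within closure Omega, continuous f} /\
               forall x, ~ closure Omega x -> f x = 0 >]].

(* C(closure Omega): functions are extended by 0 outside closure Omega, so that
   Leibniz equality is equality on closure Omega. *)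
Record contfun := ContFun {
  contfun_val :> 'rV[R]_d -> R[i]^o;
  contfun_valP : contfun_val \in cont_on_closure }.

HB.instance Definition _ := [isSub for contfun_val].
HB.instance Definition _ := [Choice of contfun by <:].

Lemma cont_on_closureP (f : 'rV[R]_d -> R[i]^o) :
  reflect ({within closure Omega, continuous f} /\
           forall x, ~ closure Omega x -> f x = 0) (f \in cont_on_closure).
Proof. by rewrite inE; exact: asboolP. Qed.

Lemma cont_on_closure_submod : submod_closed cont_on_closure.
Proof.
split=> [|a f g /cont_on_closureP[fc f0] /cont_on_closureP[gc g0]].
  apply/cont_on_closureP; split=> //.
  exact: (@cst_continuous _ _ (0 : R[i]^o)).
apply/cont_on_closureP; split=> x; last first.
  by move=> nx; rewrite !fctE/= f0// g0// scaler0 addr0.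
have afg : (fun y : subspace (closure Omega) => a *: f y + g y) y
    @[y --> x] --> a *: f x + g x.
  by apply: cvgD; [apply: cvgZl_tmp; exact: fc|exact: gc].
exact: afg.
Qed.

HB.instance Definition _ :=
  GRing.isSubmodClosed.Build _ _ cont_on_closure cont_on_closure_submod.
HB.instance Definition _ := [SubChoice_isSubLmodule of contfun by <:].

Lemma domain_compact : compact (closure Omega).
Proof.
apply: bounded_closed_compact; last exact: closed_closure.
have [M [Mreal OmegaM]] := domain_bounded Omega.
exists M; split=> // N MN x cx /=.
rewrite leNgt; apply/negP => Nx.
have nx : nbhs x [set y : 'rV[R]_d | N < `|y|].
  exact: (@cvgr_gt _ _ (nbhs x) _ _ _ (@norm_continuous R 'rV[R]_d x)).
have [y [Oy /= Ny]] := cx _ nx.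
by have /= := OmegaM _ MN y Oy; rewrite real_leNgt ?num_real// Ny.
Qed.

Definition maxnorm (f : contfun) : R :=
  sup [set cnorm (f x) | x in closure Omega].

Lemma maxnorm_max (f : contfun) : exists2 c, closure Omega c &
  maxnorm f = cnorm (f c) /\ forall x, cnorm (f x) <= cnorm (f c).
Proof.
have /cont_on_closureP[fc f0] := contfun_valP f.
have [||c cO cmax] := @compact_EVT_max _ _ (fun x => cnorm (f x)) (closure Omega)
  _ domain_compact.
- have [x Ox] := domain_nonempty Omega.
  by exists x; exact: subset_closure.
- by move=> x; apply: (cvg_comp _ _ (fc x)); exact: cnorm_continuous.
have cO' : closure Omega c by rewrite inE in cO.
exists c => //; split.
  apply/eqP; rewrite eq_le; apply/andP; split.
    apply: ge_sup; first by exists (cnorm (f c)), c.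
    by move=> _ [x Ox <-]; apply: cmax; rewrite inE.
  apply: ub_le_sup; last by exists c.
  by exists (cnorm (f c)) => _ [x Ox <-]; apply: cmax; rewrite inE.
move=> x; have [Ox|/f0 ->] := pselect (closure Omega x).
  by apply: cmax; rewrite inE.
by rewrite cnorm0 cnorm_ge0.
Qed.

Let normC (f : contfun) : R[i] := (maxnorm f)%:C.

Let normCD f g : normC (f + g) <= normC f + normC g.
Proof.
rewrite /normC -rmorphD lecR.
have [x _ [-> _]] := maxnorm_max (f + g).
have [y _ [-> fy]] := maxnorm_max f.
have [z _ [-> gz]] := maxnorm_max g.
by apply: le_trans (cnormD _ _) _; rewrite lerD.
Qed.

Let normCZ (a : R[i]) f : normC (a *: f) = `|a| * normC f.
Proof.
rewrite -[`|a|]cnormE /normC -rmorphM; congr (_%:C).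
have [x _ [-> afx]] := maxnorm_max (a *: f).
have [y _ [-> fy]] := maxnorm_max f.
have E z : cnorm ((a *: f) z) = cnorm a * cnorm (f z) by rewrite -cnormM.
apply/eqP; rewrite eq_le !E ler_wpM2l ?cnorm_ge0//=.
by have := afx y; rewrite !E.
Qed.

Let normC0 f : normC f = 0 -> f = 0.
Proof.
move=> /(@complexI R); have [x _ [-> fx]] := maxnorm_max f => f0.
apply/val_inj/funext => y /=; apply: cnorm_eq0; apply/eqP.
by rewrite eq_le cnorm_ge0 andbT -f0.
Qed.

HB.instance Definition _ :=
  Lmodule_isNormed.Build R[i] contfun normCD normCZ normC0.

Lemma contfun_cnormE (f : contfun) : cnorm f = maxnorm f.
Proof. by []. Qed.

End ContFun.

Section Smoothness.
Context (R : realType) (T : R).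

Definition deriv_on (V : normedModType R[i]) (u u' : R -> V) :=
  forall t, 0 <= t <= T ->
    ((s - t)^-1)%:C *: (u s - u t) @[s --> within `[0, T] t^'] --> u' t.

Fixpoint Cn_on (V : normedModType R[i]) (m : nat) (u : R -> V) : Prop :=
  if m is m'.+1 then exists2 u', deriv_on u u' & Cn_on m' u'
  else {within `[0, T], continuous u}.

(* L is bounded and only real-linear: C^1 is meant in the real sense, which for
   complex scalars is weaker than complex differentiability. *)
Definition bounded_real_linear (V W : normedModType R[i]) (L : V -> W) :=
  (forall (r : R) x y, L (r%:C *: x + y) = r%:C *: L x + L y) /\
  (opnorm L < +oo)%E.

(* (ft, fx) are continuous and (s, v) |-> s ft t x + fx t x v is the Frechet
   derivative of f at (t, x), relative to [0, T] x V. *)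
Definition C1_with (V W : normedModType R[i]) (f ft : R -> V -> W)
    (fx : R -> V -> V -> W) :=
  forall t x, 0 <= t <= T ->
  [/\ bounded_real_linear (fx t x),
      forall e, 0 < e -> \forall p \near (t, x), 0 <= p.1 <= T ->
        cnorm (f p.1 p.2 - f t x
               - ((p.1 - t)%:C *: ft t x + fx t x (p.2 - x)))
        <= e * Num.max `|p.1 - t| (cnorm (p.2 - x)),
      forall e, 0 < e -> \forall p \near (t, x), 0 <= p.1 <= T ->
        cnorm (ft p.1 p.2 - ft t x) <= e &
      forall e, 0 < e -> \forall p \near (t, x), 0 <= p.1 <= T ->
        (opnorm (fun v => fx p.1 p.2 v - fx t x v)%R <= e%:E)%E].

Definition C1 (V W : normedModType R[i]) (f : R -> V -> W) :=
  exists ft fx, C1_with f ft fx.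

End Smoothness.

Section Operators.
Context (R : realType).

Definition is_subspace (V : lmodType R[i]) (D : set V) :=
  D 0 /\ forall (a : R[i]) x y, D x -> D y -> D (a *: x + y).

Definition linear_on (V W : lmodType R[i]) (D : set V) (F : V -> W) :=
  forall (a : R[i]) x y, D x -> D y -> F (a *: x + y) = a *: F x + F y.

Definition is_norm_on (V : lmodType R[i]) (Z : set V) (N : V -> R) :=
  [/\ forall x y, Z x -> Z y -> N (x + y) <= N x + N y,
      forall (a : R[i]) x, Z x -> N (a *: x) = cnorm a * N x &
      forall x, Z x -> N x = 0 -> x = 0].

Context (X : normedModType R[i]).

Definition C0_semigroup (S : R -> {linear X -> X}) :=
  [/\ forall t, 0 <= t -> (opnorm (S t) < +oo)%E,
      forall x, S 0 x = x,
      forall s t x, 0 <= s -> 0 <= t -> S (s + t) x = S s (S t x) &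
      forall x, S t x @[t --> 0^'+] --> x].

Definition generator_of (S : R -> {linear X -> X}) (D : set X) (A : X -> X) :=
  forall x y, (D x /\ A x = y) <->
    (t^-1)%:C *: (S t x - x) @[t --> 0^'+] --> y.

Definition of_type (S : R -> {linear X -> X}) (omega : R) :=
  exists M : R, forall t, 0 <= t ->
    (opnorm (S t) <= (M * expR (omega * t))%:E)%E.

Definition op_inv (D : set X) (A : X -> X) (x : X) : X :=
  xget 0 [set w | D w /\ A w = x].

End Operators.

Section Continuous.
Context (R : realType) (d : nat) (Omega : bounded_domain R d).
Context (Y : completeNormedModType R[i]).
Local Notation X := (contfun Omega).

Definition ker_bd (DA : set X) (bd : X -> Y) : set X :=
  [set x | DA x /\ bd x = 0].

Record continuous_problem (T : R) (DA : set X) (A : X -> X) (bd : X -> Y)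
    (S : R -> {linear X -> X}) (omega : R) (f : R -> X -> X) (g : R -> Y)
    (u0 : X) (u : R -> X) : Prop := ContinuousProblem {
  cp_time : 0 < T;
  cp_domain : is_subspace DA;
  cp_linear : linear_on DA A;
  cp_bd_linear : linear_on DA bd;
  cp_bd_onto : forall v, exists2 x, DA x & bd x = v;
  cp_g_C1 : Cn_on T 1 g;
  cp_ker_dense : dense (ker_bd DA bd);
  cp_semigroup : C0_semigroup S;
  cp_generator : generator_of S (ker_bd DA bd) A;
  cp_omega : omega < 0;
  cp_type : of_type S omega;
  cp_steady : forall (z : R[i]) (v : Y), 0 < complex.Re z ->
    exists! x, [/\ DA x, A x = z *: x & bd x = v];
  cp_steady_bound : exists omega0 C : R, omega < omega0 /\
    forall (z : R[i]) x, 0 < complex.Re z -> omega0 <= complex.Re z ->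
      DA x -> A x = z *: x -> cnorm x <= C * cnorm (bd x);
  cp_f_C1 : C1 T f;
  cp_u_C1 : Cn_on T 1 u;
  cp_u_domain : forall t, 0 <= t <= T -> DA (u t);
  cp_Au_cont : {within `[0, T], continuous (fun t => A (u t))};
  cp_equation : deriv_on T u (fun t => A (u t) + f t (u t));
  cp_initial : u 0 = u0;
  cp_boundary : forall t, 0 <= t <= T -> bd (u t) = g t }.

End Continuous.

(* The limit is taken in the space of matrices with the maximum norm. *)
Definition expmx (R : realType) (N : nat) (M : 'M[R[i]]_N) : 'M[R[i]]_N :=
  limn (series (fun m : nat => (m`!%:R)^-1 *: M ^+ m)).

Section Discretization.
Context (R : realType) (d : nat) (Omega : bounded_domain R d).
Context (Y : completeNormedModType R[i]).
Local Notation X := (contfun Omega).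

Record space_disc := SpaceDisc {
  sd_dim : nat;
  sd_node : 'I_sd_dim -> 'rV[R]_d;
  sd_A : 'M[R[i]]_sd_dim;
  sd_C : {linear Y -> 'cV[R[i]]_sd_dim};
  sd_f : R -> 'cV[R[i]]_sd_dim -> 'cV[R[i]]_sd_dim;
  sd_R : X -> 'cV[R[i]]_sd_dim }.

Definition sd_P (D : space_disc) (x : X) : 'cV[R[i]]_(sd_dim D) :=
  \col_i x (sd_node i).

(* The data with mesh parameter h is disc h, for h in the set H of positive mesh
   parameters; Z carries the norm nZ. The derivative of f with respect to the
   vector variable is bounded by L on the tube of radius delta around the grid
   values of u. *)
Record discretization (T : R) (DA : set X) (A : X -> X) (bd : X -> Y)
    (S : R -> {linear X -> X}) (f : R -> X -> X) (u : R -> X)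
    (Z : set X) (nZ : X -> R) (H : set R) (disc : R -> space_disc)
    (eps eta : R -> R) (delta L : R) : Prop := Discretization {
  di_mesh : forall h, H h -> 0 < h;
  di_grid : forall h, H h ->
    injective (@sd_node (disc h)) /\
    forall i, closure Omega (@sd_node (disc h) i);
  di_contraction : forall h t, H h -> 0 <= t ->
    (opnorm (fun v : 'cV[R[i]]__ => (expmx (t%:C *: sd_A (disc h)) *m v)%R)
     <= 1)%E;
  di_unit : forall h, H h -> sd_A (disc h) \in unitmx;
  di_inv_bound : exists C : R, forall h, H h ->
    (opnorm (fun v : 'cV[R[i]]__ => (invmx (sd_A (disc h)) *m v)%R)
     <= C%:E)%E;
  di_R : forall h x, H h -> DA x ->
    sd_A (disc h) *m sd_R (disc h) x + sd_C (disc h) (bd x)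
    = sd_P (disc h) (A x);
  di_Z_subspace : is_subspace Z;
  di_Z_domain : Z `<=` DA;
  di_Z_norm : is_norm_on Z nZ;
  di_Z_inv : forall x, Z x -> Z (op_inv (ker_bd DA bd) A x);
  di_Z_semigroup : forall t x, 0 <= t <= T -> Z x -> Z (S t x);
  di_Z_f : forall t x, 0 <= t <= T -> Z x -> Z (f t x);
  di_eps : forall h x, H h -> Z x ->
    cnorm (sd_A (disc h) *m (sd_P (disc h) x - sd_R (disc h) x))
    <= eps h * nZ x;
  di_eta : forall h x, H h -> Z x ->
    cnorm (sd_P (disc h) x - sd_R (disc h) x) <= eta h * nZ x;
  di_eps_ge0 : forall h, H h -> 0 <= eps h;
  di_eta_ge0 : forall h, H h -> 0 <= eta h;
  di_eps_small : eps h @[h --> within H 0^'+] --> (0 : R);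
  di_eta_small : eta h @[h --> within H 0^'+] --> (0 : R);
  di_C_bound : exists C : R, forall h, H h ->
    (opnorm (fun v : Y => (invmx (sd_A (disc h)) *m sd_C (disc h) v)%R)
     <= C%:E)%E;
  di_f_grid : forall h t x, H h -> 0 <= t <= T ->
    sd_P (disc h) (f t x) = @sd_f (disc h) t (sd_P (disc h) x);
  di_delta : 0 < delta;
  di_f_C1 : forall h, H h ->
    exists ft fx, C1_with T (@sd_f (disc h)) ft fx /\
      forall t v, 0 <= t <= T ->
        cnorm (v - sd_P (disc h) (u t)) <= delta ->
        (opnorm (fx t v) <= L%:E)%E }.

End Discretization.

Record tableau (R : realType) (s : nat) := Tableau {
  rk_a : 'I_s -> 'I_s -> R;
  rk_b : 'I_s -> R;
  rk_c : 'I_s -> R }.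

(* Only evaluations of f, g at times in [t_n, t_(n+1)] and exponentials
   e^(tau A_(h,0)) with tau >= 0 occur in the scheme. *)
Definition forward_tableau (R : realType) (s : nat) (tab : tableau R s) :=
  (forall i, 0 <= rk_c tab i <= 1) /\
  forall i j : 'I_s, (j < i)%N -> rk_a tab i j != 0 ->
    rk_c tab j <= rk_c tab i.

Section Lawson.
Context (R : realType) (d : nat) (Omega : bounded_domain R d).
Context (Y : completeNormedModType R[i]) (s : nat) (tab : tableau R s).
Context (D : space_disc Omega Y) (g : R -> Y) (u : R -> contfun Omega).
Context (k : R) (n : nat).
Local Notation CN := 'cV[R[i]]_(sd_dim D).
Local Notation a := (rk_a tab).
Local Notation b := (rk_b tab).
Local Notation c := (rk_c tab).
Local Notation tn := (n%:R * k).
Local Notation etA tau := (expmx ((tau)%:C *: sd_A D)).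

Definition lawson_rhs (K : 'I_s -> CN) (j : 'I_s) : CN :=
  sd_C D (g (tn + c j * k)) + @sd_f _ _ _ _ D (tn + c j * k) (K j).

Definition lawson_stage_map (K : 'I_s -> CN) (i : 'I_s) : CN :=
  etA (c i * k) *m sd_P D (u tn) +
  k%:C *: \sum_(j < s | (j < i)%N)
    (a i j)%:C *: (etA ((c i - c j) * k) *m lawson_rhs K j).

(* Stage i only depends on the stages j < i, so s sweeps compute all of them;
   lawson_stageE is the recursion in the usual form. *)
Definition lawson_stage : 'I_s -> CN :=
  iter s lawson_stage_map (fun=> 0).

Lemma lawson_stageE i : lawson_stage i = lawson_stage_map lawson_stage i.
Proof.
have stab m m' (j : 'I_s) : (j < m <= m')%N ->
    iter m lawson_stage_map (fun=> 0) j = iter m' lawson_stage_map (fun=> 0) j.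
  elim: m m' j => [|m IH] [|m'] j; rewrite ?ltn0 ?andbF// ltnS => /andP[jm mm'].
  rewrite !iterS /lawson_stage_map; congr (_ + _ *: _).
  apply: eq_bigr => l lj; rewrite /lawson_rhs (IH m')//.
  by rewrite (leq_trans lj jm).
rewrite -[RHS]/(iter s.+1 lawson_stage_map (fun=> 0) i).
by apply: stab; rewrite ltn_ord leqnSn.
Qed.

Definition lawson_step : CN :=
  etA k *m sd_P D (u tn) +
  k%:C *: \sum_(i < s)
    (b i)%:C *: (etA ((1 - c i) * k) *m lawson_rhs lawson_stage i).

Definition local_error : CN := lawson_step - sd_P D (u (n.+1%:R * k)).

End Lawson.

(* The stages computed with stepsizes k <= kmax stay in the tube of radius delta
   around the grid values of the solution. *)
Definition stages_stay (R : realType) (d : nat) (Omega : bounded_domain R d)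
    (Y : completeNormedModType R[i]) (T : R) (g : R -> Y)
    (u : R -> contfun Omega) (H : set R) (disc : R -> space_disc Omega Y)
    (delta : R) (s : nat) (tab : tableau R s) (kmax : R) :=
  forall h k (n : nat) i, H h -> 0 < k <= kmax -> n.+1%:R * k <= T ->
    cnorm (lawson_stage tab (disc h) g u k n i
           - sd_P (disc h) (u (n%:R * k + rk_c tab i * k))) <= delta.

(* Main.v *)
(* The semigroup e^(tA_h) is a contraction, so |e^(tA_h) v - v| <= t |A_h v|. Since
   u(t) lies in Z and satisfies the homogeneous boundary condition,
   A_h P_h u = A_h (P_h u - R_h u) + P_h A u is bounded uniformly in h; hence all
   stages, and the step itself, are O(k)-close to P_h u(t_n), which gives the first
   bound. After multiplication by A_h^-1 one order is gained:
   A_h^-1 (e^(kA_h) - I) P_h u = k P_h u + O(k^2),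
   A_h^-1 e^(tau A_h) F = A_h^-1 F + O(k) for 0 <= tau <= k, and f at each stage is
   P_h f(t_n, u(t_n)) + O(k). With sum b_i = 1 and u' = A u + f this leaves
   k (P_h u - A_h^-1 P_h A u) + O(k^2) = k (P_h u - R_h u) + O(k^2)
   = O(eta_h k + k^2). *)
Require Import Defs.
From mathcomp Require Import all_boot all_order all_algebra.
From mathcomp Require Import all_classical all_reals all_analysis.
From mathcomp Require Import complex.
From mathcomp Require Import ring lra.
Import Order.TTheory GRing.Theory Num.Theory.
Import numFieldNormedType.Exports.
Local Open Scope classical_set_scope.
Local Open Scope ring_scope.
Local Open Scope complex_scope.

Set Implicit Arguments.
Unset Strict Implicit.
Unset Printing Implicit Defensive.

(** * Norms and the mean value inequality *)

Section Cnorm.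
Context (R : realType).

Lemma cnormN (V : normedZmodType R[i]) (x : V) : cnorm (- x) = cnorm x.
Proof. by rewrite /cnorm normrN. Qed.

Lemma cnormB (V : normedZmodType R[i]) (x y : V) : cnorm (x - y) = cnorm (y - x).
Proof. by rewrite /cnorm distrC. Qed.

Lemma cnorm_sum (V : normedZmodType R[i]) (I : Type) (r : seq I) (P : pred I)
    (F : I -> V) :
  cnorm (\sum_(i <- r | P i) F i) <= \sum_(i <- r | P i) cnorm (F i).
Proof.
elim/big_rec2 : _ => [|i y x _ xy]; first by rewrite cnorm0.
by rewrite (le_trans (cnormD _ _))// lerD2l.
Qed.

Lemma cnormZ (V : normedModType R[i]) (a : R[i]) (x : V) :
  cnorm (a *: x) = cnorm a * cnorm x.
Proof. by apply: (@complexI R); rewrite rmorphM/= !cnormE normrZ. Qed.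

Lemma cnormR (a : R) : cnorm a%:C = `|a|.
Proof. by apply: (@complexI R); rewrite cnormE normc_def /= expr0n addr0 sqrtr_sqr. Qed.

Lemma cnormZR (V : normedModType R[i]) (a : R) (x : V) :
  cnorm (a%:C *: x) = `|a| * cnorm x.
Proof. by rewrite cnormZ cnormR. Qed.

Lemma cnorm_dist (V : normedZmodType R[i]) (z x y : V) :
  cnorm (x - y) <= cnorm (x - z) + cnorm (z - y).
Proof. by rewrite (le_trans _ (cnormD _ _))// addrA subrK. Qed.

Lemma cnorm_le_distD (V : normedZmodType R[i]) (x y : V) :
  cnorm x <= cnorm (x - y) + cnorm y.
Proof. by rewrite (le_trans _ (cnormD _ _))// subrK. Qed.

Lemma cnorm_cvg_lt (V : normedModType R[i]) (I : Type) (F : set_system I)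
    {FF : Filter F} (f : I -> V) (l : V) (e : R) :
  f @ F --> l -> 0 < e -> \forall i \near F, cnorm (f i - l) < e.
Proof.
move=> fl e0; have e0C : 0 < e%:C by rewrite ltcR.
move/cvgrPdist_lt : fl => /(_ _ e0C); apply: filterS => i.
by rewrite -ltcR cnormE distrC.
Qed.

Lemma cvg_cnorm_lt (V : normedModType R[i]) (I : Type) (F : set_system I)
    {FF : Filter F} (f : I -> V) (l : V) :
  (forall e : R, 0 < e -> \forall i \near F, cnorm (f i - l) < e) ->
  f @ F --> l.
Proof.
move=> fl; apply/cvgrPdist_lt => e e0.
have eE : e = (complex.Re e)%:C.
  by case: e e0 => a b; rewrite ltcE/= => /andP[/eqP -> _].
have e0' : 0 < complex.Re e by rewrite -ltcR -eE.
by move: (fl _ e0'); apply: filterS => i; rewrite -ltcR cnormE -eE distrC.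
Qed.

Lemma Re_le_cnorm (z : R[i]) : `|complex.Re z| <= cnorm z.
Proof.
case: z => a b; rewrite /cnorm normc_def/= -(sqrtr_sqr a) ler_wsqrtr// lerDl.
exact: sqr_ge0.
Qed.

Lemma Im_le_cnorm (z : R[i]) : `|complex.Im z| <= cnorm z.
Proof.
case: z => a b; rewrite /cnorm normc_def/= -(sqrtr_sqr b) ler_wsqrtr// lerDr.
exact: sqr_ge0.
Qed.

Lemma cnorm_le_ReIm (z : R[i]) :
  cnorm z <= `|complex.Re z| + `|complex.Im z|.
Proof.
case: z => a b; rewrite /cnorm normc_def/= -[leRHS]ger0_norm ?addr_ge0//.
rewrite -(sqrtr_sqr (_ + _)) ler_wsqrtr// sqrrD !real_normK ?num_real//.
by rewrite addrAC lerDl mulrn_wge0// mulr_ge0.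
Qed.

(** Scaling [v] by the real number [(cnorm v)^-1] puts it in the unit ball, so homogeneity over the
    reals suffices; the derivatives in [C1_with] are only real-linear. *)
Lemma opnorm_le (V W : normedModType R[i]) (B : V -> W) (L : R) (v : V) :
  (forall (r : R) w, B (r%:C *: w) = r%:C *: B w) ->
  (opnorm B <= L%:E)%E -> cnorm (B v) <= L * cnorm v.
Proof.
move=> BZ BL.
have H w : cnorm w <= 1 -> cnorm (B w) <= L.
  move=> w1; rewrite -lee_fin; apply: le_trans BL.
  by apply: ereal_sup_ubound; exists w.
have [v0|v0] := eqVneq (cnorm v) 0.
  have -> : v = 0 by exact: cnorm_eq0.
  have := BZ 0 0; rewrite !scale0r => ->.
  by rewrite !cnorm0 mulr0.
have vp : 0 < cnorm v by rewrite lt_def v0 cnorm_ge0.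
have /H : cnorm ((cnorm v)^-1%:C *: v) <= 1.
  by rewrite cnormZR ger0_norm ?invr_ge0 ?cnorm_ge0// mulVf.
rewrite BZ cnormZR ger0_norm ?invr_ge0 ?cnorm_ge0//.
by rewrite mulrC ler_pdivrMr.
Qed.

End Cnorm.

Section Interval.
Context (R : realType).

(** Compactness of the segment in its near-covering form, with the bound [M] running along the
    filter at infinity; monotonicity in [M] turns a local bound into an eventual one. *)
Lemma locally_bounded_segment (a b : R) (P : R -> R -> Prop) :
  (forall M M' t, M <= M' -> P M t -> P M' t) ->
  (forall t, a <= t <= b -> exists M, \forall r \near t, a <= r <= b -> P M r) ->
  exists M, forall t, a <= t <= b -> P M t.
Proof.
move=> Ple Pb.
have /compact_near_coveringP : compact `[a, b] by exact: segment_compact.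
move=> /(_ R (pinfty_nbhs R) (fun M t => a <= t <= b -> P M t) _) cov.
have : \forall M \near +oo, `[a, b] `<=` (fun t => a <= t <= b -> P M t).
  apply: cov => t; rewrite /= in_itv/= => tab.
  have [M PM] := Pb t tab.
  exists ([set r | a <= r <= b -> P M r], [set M' | M <= M']) => /=.
    by split=> //; exists M; split=> [|x]; [exact: num_real|exact: ltW].
  by move=> [r M'] /= [H1 H2] /H1; apply: Ple.
move=> [M [_ HM]]; exists (M + 1) => t tab.
by apply: (HM (M + 1)) => //; rewrite ?ltrDl// /= in_itv.
Qed.

(* The set of the [x] at which the inequality holds with [M + e] in place of [M]
   contains its supremum, which can only be [b]. *)
Lemma mean_value_ineq (V : normedZmodType R[i]) (a b M : R) (phi : R -> V) :
  a <= b ->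
  (forall t, a <= t <= b -> forall e, 0 < e ->
     \forall r \near t, a <= r <= b ->
       cnorm (phi r - phi t) <= (M + e) * `|r - t|) ->
  cnorm (phi b - phi a) <= M * (b - a).
Proof.
move=> ab slope.
(* The slack [e] is removed at the end by taking [e / (b - a)], which leaves an arbitrary additive
   error. *)
suff H e : 0 < e -> cnorm (phi b - phi a) <= (M + e) * (b - a).
  have [->|nab] := eqVneq a b; first by rewrite !subrr cnorm0 mulr0.
  have ba0 : 0 < b - a by rewrite subr_gt0 lt_neqAle nab.
  apply/ler_addgt0Pr => e e0.
  have := H (e / (b - a)) (divr_gt0 e0 ba0).
  by rewrite mulrDl divfK// gt_eqF.
move=> e0.
pose E := [set x | a <= x <= b /\ cnorm (phi x - phi a) <= (M + e) * (x - a)].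
have Ea : E a by split; rewrite ?lexx// !subrr cnorm0 mulr0.
have Eb : has_ubound E by exists b => x [/andP[]].
have Es : has_sup E by split; [exists a|].
set c := sup E.
have ac : a <= c by exact: ub_le_sup.
have cb : c <= b by apply: ge_sup; [exists a|move=> x [/andP[]]].
have /slope /(_ _ e0) : a <= c <= b by rewrite ac.
move=> /nbhs_ballP[d /= d0 dP].
have {}dP r : a <= r <= b -> `|r - c| < d ->
    cnorm (phi r - phi c) <= (M + e) * `|r - c|.
  by move=> rab rd; apply: dP => //; rewrite /ball/= distrC.
(* Some point of [E] lies within [d] of the supremum; the slope bound at [c] carries the inequality
   from it to [c]. *)
have Ec : cnorm (phi c - phi a) <= (M + e) * (c - a).
  have [x [xab Ex] xc] := sup_adherent d0 Es; rewrite -/c in xc.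
  have xlec : x <= c by exact: ub_le_sup.
  have xcE : `|x - c| = c - x by rewrite ler0_norm ?opprB// subr_le0.
  have := dP x xab; rewrite xcE => /(_ ltac:(lra)).
  rewrite cnormB => H1; apply: le_trans (cnorm_dist (phi x) _ _) _.
  by apply: le_trans (lerD H1 Ex) _; rewrite -mulrDr addrA subrK.
have [->//|ncb] := eqVneq b c.
have {}cb : c < b by rewrite lt_neqAle cb eq_sym ncb.
(* If [c < b], the slope bound at [c] extends the inequality to this point beyond the supremum, a
   contradiction. *)
pose x := Num.min b (c + d / 2).
have cx : c < x by rewrite /x lt_min cb ltrDl divr_gt0.
have xb : x <= b by rewrite /x ge_min lexx.
have xd : x <= c + d / 2 by rewrite /x ge_min lexx orbT.
suff Ex : E x by have := ub_le_sup Eb Ex; rewrite -/c leNgt cx.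
have xab : a <= x <= b by rewrite xb andbT (le_trans ac)// ltW.
split=> //.
have := dP x xab; rewrite gtr0_norm ?subr_gt0// => /(_ ltac:(lra)) H1.
apply: le_trans (cnorm_dist (phi c) _ _) _.
by apply: le_trans (lerD H1 Ec) _; rewrite -mulrDr addrA subrK.
Qed.

End Interval.

(** * The matrix exponential *)

Section MatrixNorm.
Context (R : realType).

Lemma cnorm_mx_le m n (M : 'M[R[i]]_(m, n)) (e : R) : 0 <= e ->
  (forall i j, cnorm (M i j) <= e) -> cnorm M <= e.
Proof.
move=> e0 Me; rewrite -lecR cnormE (_ : `|M| = mx_norm M)//.
have [->|/mx_norm_neq0[[i j] ->]] := eqVneq (mx_norm M) 0.
  by rewrite lecR.
by rewrite -cnormE lecR.
Qed.

Lemma cnorm_mx_entry m n (M : 'M[R[i]]_(m, n)) i j : cnorm (M i j) <= cnorm M.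
Proof.
rewrite -lecR !cnormE [leRHS]mx_normE -[leLHS]nngE num_le.
exact: (le_bigmax _ (fun ij => `|M ij.1 ij.2|%:nng) (i, j)).
Qed.

(** The norm is the largest modulus of an entry, which is not submultiplicative; the factor counts
    the terms in an entry of the product. *)
Lemma cnorm_mulmx m n p (M : 'M[R[i]]_(m, n)) (C : 'M[R[i]]_(n, p)) :
  cnorm (M *m C) <= n%:R * cnorm M * cnorm C.
Proof.
apply: cnorm_mx_le => [|i j]; first by rewrite !mulr_ge0// cnorm_ge0.
rewrite mxE (le_trans (cnorm_sum _ _ _))//.
rewrite -mulrA mulr_natl -[X in _ *+ X]card_ord -sumr_const.
by apply: ler_sum => l _; rewrite cnormM ler_pM ?cnorm_ge0// cnorm_mx_entry.
Qed.

(* Stated with the norm because no topology is inferred for ['M[R[i]]_(m, n)] from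
   the bare type [R[i]]. *)
Definition cnorm_cvg (V : normedZmodType R[i]) (I : Type) (F : set_system I)
    (x : I -> V) (l : V) :=
  forall e : R, 0 < e -> \forall i \near F, cnorm (x i - l) < e.

Lemma cnorm_cvg_unique (V : normedZmodType R[i]) (I : Type) (F : set_system I)
    {FF : ProperFilter F} (x : I -> V) (l l' : V) :
  cnorm_cvg F x l -> cnorm_cvg F x l' -> l = l'.
Proof.
move=> xl xl'; apply/eqP; rewrite -subr_eq0; apply/eqP/cnorm_eq0/eqP.
rewrite eq_le cnorm_ge0 andbT; apply/ler_addgt0Pr => e e0; rewrite add0r.
have e20 : 0 < e / 2 by rewrite divr_gt0.
have [i [h1 h2]] := @filter_ex _ F FF _ (filterI (xl _ e20) (xl' _ e20)).
rewrite -(subrK (x i) l) -addrA (le_trans (cnormD _ _))// (splitr e).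
by rewrite lerD// ltW// cnormB.
Qed.

Lemma lim_cnorm_cvg (V : normedModType R[i]) (x : nat -> V) (l : V) :
  cnorm_cvg \oo x l -> limn x = l.
Proof. by move=> xl; apply: cvg_lim; [exact: norm_hausdorff|exact: cvg_cnorm_lt]. Qed.

Lemma cnorm_cvg_mulmxr (I : Type) (F : set_system I) {FF : Filter F} m n p
    (M : I -> 'M[R[i]]_(m, n)) (L : 'M[R[i]]_(m, n)) (C : 'M[R[i]]_(n, p)) :
  cnorm_cvg F M L -> cnorm_cvg F (fun i => M i *m C) (L *m C).
Proof.
move=> ML e e0.
(* Adding 1 keeps the divisor positive when [C] is zero. *)
have c0 : 0 < n%:R * cnorm C + 1 by rewrite ltr_wpDl// mulr_ge0// cnorm_ge0.
have := ML _ (divr_gt0 e0 c0).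
apply: filterS => i; rewrite ltr_pdivlMr// => Me.
rewrite -mulmxBl (le_lt_trans (cnorm_mulmx _ _))// (le_lt_trans _ Me)//.
by rewrite mulrAC mulrC ler_wpM2l ?cnorm_ge0// lerDl.
Qed.

Lemma cnorm_cvg_mulmxl (I : Type) (F : set_system I) {FF : Filter F} m n p
    (M : I -> 'M[R[i]]_(n, p)) (L : 'M[R[i]]_(n, p)) (C : 'M[R[i]]_(m, n)) :
  cnorm_cvg F M L -> cnorm_cvg F (fun i => C *m M i) (C *m L).
Proof.
move=> ML e e0.
have c0 : 0 < n%:R * cnorm C + 1 by rewrite ltr_wpDl// mulr_ge0// cnorm_ge0.
have := ML _ (divr_gt0 e0 c0).
apply: filterS => i; rewrite ltr_pdivlMr// => Me.
rewrite -mulmxBr (le_lt_trans (cnorm_mulmx _ _))// (le_lt_trans _ Me)//.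
by rewrite mulrC ler_wpM2l ?cnorm_ge0// lerDl.
Qed.

Lemma cnorm_cvg_mx_ReIm (I : Type) (F : set_system I) {FF : Filter F} m n
    (M : I -> 'M[R[i]]_(m, n)) (re im : 'I_m -> 'I_n -> R) :
  (forall a b, (fun i => complex.Re (M i a b)) @ F --> re a b) ->
  (forall a b, (fun i => complex.Im (M i a b)) @ F --> im a b) ->
  cnorm_cvg F M (\matrix_(a, b) ((re a b) +i* (im a b))).
Proof.
move=> reP imP e e0.
(* Passing to the maximum over the entries only preserves weak inequalities; two thirds of [e] leave
   the final one strict. *)
have e20 : 0 < e / 3 by rewrite divr_gt0.
have H : \forall i \near F, forall ab : 'I_m * 'I_n,
    `|complex.Re (M i ab.1 ab.2) - re ab.1 ab.2| < e / 3 /\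
    `|complex.Im (M i ab.1 ab.2) - im ab.1 ab.2| < e / 3.
  apply: filter_forall => -[a b] /=; apply: filterI.
    move/cvgrPdist_lt : (reP a b) => /(_ _ e20); apply: filterS => i.
    by rewrite distrC.
  move/cvgrPdist_lt : (imP a b) => /(_ _ e20); apply: filterS => i.
  by rewrite distrC.
apply: filterS H => i H; apply: (@le_lt_trans _ _ (e / 3 * 2)); last by lra.
apply: cnorm_mx_le => [|a b]; first by rewrite mulr_ge0// ltW.
rewrite !mxE (le_trans (cnorm_le_ReIm _))//.
have [/= /ltW h1 /ltW h2] := H (a, b).
move: (M i a b) h1 h2 => [x y] /= h1 h2.
by rewrite mulr2n mulrDr mulr1 lerD.
Qed.

End MatrixNorm.

Lemma cnorm_mx_ReIm_le (R : realType) m n (M1 M2 M3 : 'M[R[i]]_(m, n))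
    (x1 y1 x2 y2 x3 y3 : 'I_m -> 'I_n -> R) (a e : R) :
  M1 = \matrix_(i, j) (x1 i j +i* y1 i j) ->
  M2 = \matrix_(i, j) (x2 i j +i* y2 i j) ->
  M3 = \matrix_(i, j) (x3 i j +i* y3 i j) -> 0 <= e ->
  (forall i j, `|x1 i j - x2 i j - a * x3 i j|
    + `|y1 i j - y2 i j - a * y3 i j| <= e) ->
  cnorm (M1 - M2 - a%:C *: M3) <= e.
Proof.
move=> -> -> -> e0 H; apply: cnorm_mx_le => // i j.
apply: le_trans (H i j); rewrite !mxE.
have -> : (x1 i j +i* y1 i j) - (x2 i j +i* y2 i j) - a%:C * (x3 i j +i* y3 i j)
  = (x1 i j - x2 i j - a * x3 i j) +i* (y1 i j - y2 i j - a * y3 i j) by simpc.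
exact: cnorm_le_ReIm.
Qed.

(** The difference quotient multiplied out, so that [r = t] is included and the mean value
    inequality can use it. *)
Lemma is_derive_taylor (R : realType) (F : R -> R) (t l e : R) :
  is_derive t 1 F l -> 0 < e ->
  \forall r \near t, `|F r - F t - (r - t) * l| <= e * `|r - t|.
Proof.
move=> [Fd Fl] e0.
have : (h^-1 *: ((F \o shift t) (h *: 1) - F t)) @[h --> 0^'] --> l.
  by rewrite -Fl; exact: Fd.
move=> /cvgrPdist_lt /(_ _ e0) /nbhs_ballP[d /= d0 dP].
apply/nbhs_ballP; exists d => //= r.
rewrite /ball/= => rtd.
have [->|rt] := eqVneq r t; first by rewrite !subrr mul0r subr0 !normr0 mulr0.
have rt0 : r - t != 0 by rewrite subr_eq0.
have /dP /(_ rt0) : ball 0 d (r - t) by rewrite /ball/= sub0r opprB.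
rewrite /= [_ *: 1]mulr1 subrK => /ltW H.
have -> : F r - F t - (r - t) * l
    = - (r - t) * (l - (r - t)^-1 * (F r - F t)).
  by field.
by rewrite normrM normrN mulrC ler_wpM2r.
Qed.

Section Exponential.
Context (R : realType) (N : nat) (B : 'M[R[i]]_N).

(* [l] stands for the real and for the imaginary part. *)
Section Component.
Variable l : R[i] -> R.
Hypothesis lD : {morph l : x y / x + y}.
Hypothesis lZ : forall (r : R) z, l (r%:C * z) = r * l z.
Hypothesis l_le : forall z, `|l z| <= cnorm z.

(** Coefficient of [t ^ m] in the component [l] of entry [(i, j)] of [e^(tB) C]; the theory of real
    power series then applies. *)
Definition exp_coef p (C : 'M[R[i]]_(N, p)) i j (m : nat) : R :=
  l ((B ^+ m *m C) i j) / m`!%:R.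

(** Formal differentiation cancels one factor of the factorial and moves one [B] onto [C]: the
    derivative of [e^(tB) C] is [e^(tB) B C]. *)
Lemma exp_coef_diffs p (C : 'M[R[i]]_(N, p)) i j :
  pseries_diffs (exp_coef C i j) = exp_coef (B *m C) i j.
Proof.
apply/funext => m; rewrite /pseries_diffs /exp_coef exprSr mulmxA.
by rewrite factS natrM invfM mulrCA mulVKf ?pnatr_eq0.
Qed.

Lemma cnorm_exprmx p (C : 'M[R[i]]_(N, p)) m :
  cnorm (B ^+ m *m C) <= (N%:R * cnorm B) ^+ m * cnorm C.
Proof.
elim: m => [|m IH]; first by rewrite expr0 mul1mx mul1r.
rewrite exprS -[B * _]/(B *m _) -mulmxA (le_trans (cnorm_mulmx _ _))//.
by rewrite exprS -[leRHS]mulrA ler_wpM2l// mulr_ge0// cnorm_ge0.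
Qed.

(** Comparison with the scalar exponential series at [N |B| |K|]. *)
Lemma cvg_exp_coef p (C : 'M[R[i]]_(N, p)) i j K :
  cvgn (pseries (exp_coef C i j) K).
Proof.
apply: normed_cvg; apply: (@series_le_cvg _ _
  (fun n => cnorm C * exp_coeff (N%:R * cnorm B * `|K|) n)) => [n|n|n|].
- by rewrite normr_ge0.
- by rewrite mulr_ge0 ?cnorm_ge0// exp_coeff_ge0// !mulr_ge0// cnorm_ge0.
- rewrite /exp_coef /exp_coeff /= !normrM normrX normfV normr_nat.
  rewrite exprMn mulrAC mulrA mulrA ler_wpM2r ?invr_ge0//.
  rewrite ler_wpM2r ?exprn_ge0// (le_trans (l_le _))//.
  by rewrite (le_trans (cnorm_mx_entry _ _ _))// mulrC cnorm_exprmx.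
- have := @is_cvg_seriesZ _ (exp_coeff (N%:R * cnorm B * `|K|)) (cnorm C).
  by apply; exact: is_cvg_series_exp_coeff.
Qed.

Lemma exp_coef_derive p (C : 'M[R[i]]_(N, p)) i j (t : R) :
  is_derive t 1 (fun t : R => limn (pseries (exp_coef C i j) t))
    (limn (pseries (exp_coef (B *m C) i j) t)).
Proof.
(* Termwise differentiation at [t] needs the series and its first two formal derivatives to converge
   at a radius exceeding [|t|]. *)
rewrite -exp_coef_diffs; apply: (@pseries_snd_diffs _ _ (`|t| + 1)).
- exact: cvg_exp_coef.
- by rewrite exp_coef_diffs; exact: cvg_exp_coef.
- by rewrite !exp_coef_diffs; exact: cvg_exp_coef.
- by rewrite [ltRHS]ger0_norm ?addr_ge0// ltrDl.
Qed.

Lemma exp_partial_sum p (C : 'M[R[i]]_(N, p)) i j t n :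
  l ((series (fun m => (m`!%:R)^-1 *: (t%:C *: B) ^+ m) n *m C) i j)
  = pseries (exp_coef C i j) t n.
Proof.
have l0 : l 0 = 0 by have := lZ 0 0; rewrite mulr0 mul0r.
rewrite /pseries /series /= mulmx_suml summxE.
elim/big_rec2 : _ => [|m y x _ <-]; first by [].
rewrite lD; congr (_ + _).
have -> : (t%:C *: B) ^+ m = (t ^+ m)%:C *: B ^+ m.
  elim: (m) => [|k IH]; first by rewrite !expr0 scale1r.
  rewrite !exprS IH -[X in X = _]/((t%:C *: B) *m (_ *: _)).
  by rewrite -scalemxAl -scalemxAr scalerA -rmorphM.
rewrite scalerA -scalemxAl mxE.
have -> : (m`!%:R^-1 * (t ^+ m)%:C : R[i]) = (t ^+ m / m`!%:R)%:C.
  by rewrite rmorphM/= fmorphV rmorph_nat mulrC.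
by rewrite lZ /exp_coef mulrC mulrA mulrAC.
Qed.

End Component.

Let ReD : {morph (@complex.Re R) : x y / x + y}. Proof. by case=> ? ? []. Qed.
Let ImD : {morph (@complex.Im R) : x y / x + y}. Proof. by case=> ? ? []. Qed.
Let ReZ (r : R) z : complex.Re (r%:C * z) = r * complex.Re z.
Proof. by case: z => a b /=; rewrite mul0r subr0. Qed.
Let ImZ (r : R) z : complex.Im (r%:C * z) = r * complex.Im z.
Proof. by case: z => a b /=; rewrite mul0r addr0. Qed.

Let exp_series_cvg p (C : 'M[R[i]]_(N, p)) t :
  cnorm_cvg \oo
    (fun n => series (fun m => (m`!%:R)^-1 *: (t%:C *: B) ^+ m) n *m C)
    (\matrix_(i, j)
      (limn (pseries (exp_coef (@complex.Re R) C i j) t) +i*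
       limn (pseries (exp_coef (@complex.Im R) C i j) t))).
Proof.
apply: cnorm_cvg_mx_ReIm => i j.
- rewrite (_ : (fun n => _) = pseries (exp_coef (@complex.Re R) C i j) t).
    by apply: cvg_exp_coef => // z; exact: Re_le_cnorm.
  by apply/funext => n; rewrite -exp_partial_sum.
- rewrite (_ : (fun n => _) = pseries (exp_coef (@complex.Im R) C i j) t).
    by apply: cvg_exp_coef => // z; exact: Im_le_cnorm.
  by apply/funext => n; rewrite -exp_partial_sum.
Qed.

(** [expmx] is defined by [limn], which is informative only once convergence is known; the entrywise
    limit supplies it. *)
Lemma expmx_cvg t :
  cnorm_cvg \oo (series (fun m => (m`!%:R)^-1 *: (t%:C *: B) ^+ m))
    (expmx (t%:C *: B)).
Proof.
have := exp_series_cvg 1%:M t; set L := \matrix_(i, j) _.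
rewrite (_ : (fun n => _) = series (fun m => (m`!%:R)^-1 *: (t%:C *: B) ^+ m));
  last by apply/funext => n; rewrite mulmx1.
move=> H; suff -> : expmx (t%:C *: B) = L by [].
exact: (@lim_cnorm_cvg _ ('M[(R[i] : numFieldType)]_N : normedModType R[i])).
Qed.

Lemma expmx_mulE p (C : 'M[R[i]]_(N, p)) t :
  expmx (t%:C *: B) *m C = \matrix_(i, j)
    (limn (pseries (exp_coef (@complex.Re R) C i j) t) +i*
     limn (pseries (exp_coef (@complex.Im R) C i j) t)).
Proof.
apply: cnorm_cvg_unique (exp_series_cvg C t).
exact: cnorm_cvg_mulmxr (expmx_cvg t).
Qed.

Lemma expmx_derive p (C : 'M[R[i]]_(N, p)) (t e : R) : 0 < e ->
  \forall r \near t, cnorm (expmx (r%:C *: B) *m C - expmx (t%:C *: B) *m C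
      - (r - t)%:C *: (expmx (t%:C *: B) *m (B *m C))) <= e * `|r - t|.
Proof.
move=> e0; have e20 : 0 < e / 2 by rewrite divr_gt0.
pose F l (D : 'M[R[i]]_(N, p)) (ij : 'I_N * 'I_p) (t : R) :=
  limn (pseries (exp_coef l D ij.1 ij.2) t).
have H : \forall r \near t, forall ij,
  `|F (@complex.Re R) C ij r - F (@complex.Re R) C ij t
    - (r - t) * F (@complex.Re R) (B *m C) ij t| <= e / 2 * `|r - t| /\
  `|F (@complex.Im R) C ij r - F (@complex.Im R) C ij t
    - (r - t) * F (@complex.Im R) (B *m C) ij t| <= e / 2 * `|r - t|.
  apply: (@filter_forall _ _ _ (nbhs t)) => -[i j]; apply: filterI.
    exact: is_derive_taylor (exp_coef_derive (@Re_le_cnorm R) C i j t) e20.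
  exact: is_derive_taylor (exp_coef_derive (@Im_le_cnorm R) C i j t) e20.
apply: filterS H => r H.
apply: (cnorm_mx_ReIm_le (expmx_mulE C r) (expmx_mulE C t)
  (expmx_mulE (B *m C) t)) => [|i j].
  by rewrite mulr_ge0// ltW.
by have [h1 h2] := H (i, j); rewrite (le_trans (lerD h1 h2))// -mulrDl -splitr.
Qed.

Lemma expmx0 : expmx ((0 : R)%:C *: B) = 1%:M.
Proof.
(* The partial sum of index 0 is empty; from index 1 on, every partial sum is the identity. *)
apply: cnorm_cvg_unique (expmx_cvg 0) _ => e e0; exists 1 => // -[//|n] _.
rewrite /series/= big_nat_recl//= fact0 invr1 scale1r expr0 big1 ?addr0 => [|m _].
  by rewrite subrr cnorm0.
by rewrite scale0r expr0n/= scaler0.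
Qed.

Lemma expmx_comm t : expmx (t%:C *: B) *m B = B *m expmx (t%:C *: B).
Proof.
have H1 := cnorm_cvg_mulmxr B (expmx_cvg t).
have H2 := cnorm_cvg_mulmxl B (expmx_cvg t).
apply: cnorm_cvg_unique (H1 _) _ => e /(H2 _); apply: filterS => n.
suff -> : series (fun m => (m`!%:R)^-1 *: (t%:C *: B) ^+ m) n *m B =
    B *m series (fun m => (m`!%:R)^-1 *: (t%:C *: B) ^+ m) n by [].
rewrite /series/= mulmx_suml mulmx_sumr; apply: eq_bigr => m _.
rewrite -scalemxAl -scalemxAr; congr (_ *: _).
have /commrX : GRing.comm B (t%:C *: B).
  by rewrite /GRing.comm -[LHS]/(_ *m _) -[RHS]/(_ *m _) -scalemxAl -scalemxAr.
by move=> /(_ m).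
Qed.

End Exponential.

(** Increment of a curve minus its initial tangent: [w] is the initial slope and [z] the current
    one, so the slope is [z - w] up to the first-order remainder. It serves both second-order Taylor
    bounds. *)
Lemma affine_increment (R : rcfType) (V : lmodType R[i]) (a b : R)
    (x y z w : V) :
  x - a%:C *: w - (y - b%:C *: w)
  = (a - b)%:C *: (z - w) + (x - y - (a - b)%:C *: z).
Proof.
rewrite scalerBr [RHS]addrC addrA subrK rmorphB/= scalerBl !opprB addrACA.
by rewrite [RHS]addrACA [- _ - _]addrC.
Qed.

Section MatrixOperators.
Context (R : realType).

Lemma cnorm_mxZ m n (a : R) (M : 'M[R[i]]_(m, n)) :
  cnorm (a%:C *: M) = `|a| * cnorm M.
Proof. exact: (@cnormZR R ('M[(R[i] : numFieldType)]_(m, n) : normedModType R[i])). Qed.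

Lemma opnorm_mulmx_le m n (M : 'M[R[i]]_(m, n)) (L : R) (v : 'cV[R[i]]_n) :
  (opnorm (fun v : 'cV[R[i]]_n => (M *m v)%R) <= L%:E)%E ->
  cnorm (M *m v) <= L * cnorm v.
Proof.
apply: (@opnorm_le R ('cV[(R[i] : numFieldType)]_n : normedModType R[i])
  ('cV[(R[i] : numFieldType)]_m : normedModType R[i]) (mulmx M)) => r w.
by rewrite scalemxAr.
Qed.

End MatrixOperators.

(** * Contractive matrix exponentials *)

Section Contraction.
Context (R : realType) (N : nat) (B : 'M[R[i]]_N).
Local Notation E t := (expmx ((t : R)%:C *: B)).
Hypothesis contraction :
  forall t (v : 'cV[R[i]]_N), 0 <= t -> cnorm (E t *m v) <= cnorm v.

(** The derivative [E r *m (B *m v)] is at most [cnorm (B *m v)] by contractivity. *)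
Lemma expmx_sub_le t (v : 'cV[R[i]]_N) : 0 <= t ->
  cnorm (E t *m v - v) <= t * cnorm (B *m v).
Proof.
move=> t0; have := @mean_value_ineq R _ 0 t (cnorm (B *m v)) (fun r => E r *m v) t0.
rewrite expmx0 mul1mx subr0 mulrC; apply => r /andP[r0 _] e e0.
apply: filterS (expmx_derive B v r e0) => r' H _.
rewrite -(subrK ((r' - r)%:C *: (E r *m (B *m v))) (_ - _)).
rewrite (le_trans (cnormD _ _))// [M in M <= _]addrC mulrDl lerD//.
by rewrite cnorm_mxZ mulrC ler_wpM2r// contraction.
Qed.

(** After subtracting the tangent, the slope at [r] is [(E r - 1) B v], which the first-order bound
    controls by [r], hence by [t]. The sharper factor 1/2 is not sought. *)
Lemma expmx_sub2_le t (v : 'cV[R[i]]_N) : 0 <= t ->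
  cnorm (E t *m v - v - t%:C *: (B *m v)) <= t ^+ 2 * cnorm (B *m (B *m v)).
Proof.
move=> t0.
have := @mean_value_ineq R _ 0 t (t * cnorm (B *m (B *m v)))
  (fun r => E r *m v - r%:C *: (B *m v)) t0.
rewrite expmx0 mul1mx subr0 scale0r subr0 addrAC expr2 (mulrAC t t).
apply => r /andP[r0 rt] e e0.
apply: filterS (expmx_derive B v r e0) => r' H _.
have -> : E r' *m v - r'%:C *: (B *m v) - (E r *m v - r%:C *: (B *m v)) =
    (r' - r)%:C *: (E r *m (B *m v) - B *m v) +
    (E r' *m v - E r *m v - (r' - r)%:C *: (E r *m (B *m v))).
  exact: (affine_increment r' r (E r' *m v) (E r *m v)).
rewrite (le_trans (cnormD _ _))// mulrDl lerD//.
rewrite cnorm_mxZ mulrC ler_wpM2r//.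
by rewrite (le_trans (expmx_sub_le _ r0))// ler_wpM2r// cnorm_ge0.
Qed.

Hypothesis B_unit : B \in unitmx.

Lemma expmx_invmx_comm t : E t *m invmx B = invmx B *m E t.
Proof.
have := congr1 (fun M => invmx B *m M *m invmx B) (expmx_comm B t).
by rewrite mulmxA mulKmx// -!mulmxA mulmxV// mulmx1 => ->.
Qed.

(** [expmx_sub_le] at [invmx B *m v]: the inverse absorbs the factor [B], so one order in [t] is
    gained for arbitrary [v]. *)
Lemma invmx_expmx_sub_le t (v : 'cV[R[i]]_N) : 0 <= t ->
  cnorm (invmx B *m (E t *m v - v)) <= t * cnorm v.
Proof.
move=> t0; rewrite mulmxBr mulmxA -expmx_invmx_comm -mulmxA.
by rewrite (le_trans (expmx_sub_le _ t0))// mulKVmx.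
Qed.

Lemma invmx_expmx_sub2_le t (v : 'cV[R[i]]_N) : 0 <= t ->
  cnorm (invmx B *m (E t *m v - v) - t%:C *: v) <= t ^+ 2 * cnorm (B *m v).
Proof.
move=> t0; have := expmx_sub2_le (invmx B *m v) t0; rewrite mulKVmx//.
by rewrite mulmxBr [invmx B *m (_ *m v)]mulmxA -expmx_invmx_comm -mulmxA.
Qed.

End Contraction.

(** * Differentiable functions on the time interval *)

Section DerivOn.
Context (R : realType) (T : R) (V : normedModType R[i]).
Implicit Types u : R -> V.

Lemma continuous_segment_bounded u : {within `[0, T], continuous u} ->
  exists M, forall t, 0 <= t <= T -> cnorm (u t) <= M.
Proof.
move=> /subspace_continuousP uc.
apply: (@locally_bounded_segment _ _ _ (fun M t => cnorm (u t) <= M)).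
  by move=> M M' t MM' /le_trans; apply.
move=> t tT; exists (cnorm (u t) + 1).
have /uc ut : `[0, T]%classic t by rewrite /= in_itv.
have /(_ _) := cnorm_cvg_lt ut ltr01; rewrite near_withinE.
apply: filterS => r H rT; have /H {}H : `[0, T]%classic r by rewrite /= in_itv.
by rewrite (le_trans (cnorm_le_distD _ (u t)))// addrC lerD2l ltW.
Qed.

Lemma deriv_on_taylor u u' (t e : R) : deriv_on T u u' -> 0 <= t <= T -> 0 < e ->
  \forall r \near t, 0 <= r <= T ->
    cnorm (u r - u t - (r - t)%:C *: u' t) <= e * `|r - t|.
Proof.
move=> du tT e0; have /(_ _) := cnorm_cvg_lt (du _ tT) e0.
rewrite near_withinE near_withinE.
apply: filterS => r H rT.
have [->|rt] := eqVneq r t.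
  by rewrite !subrr scale0r subr0 cnorm0 normr0 mulr0.
have rt0 : r - t != 0 by rewrite subr_eq0.
have /(H rt) {}H : `[0, T]%classic r by rewrite /= in_itv.
have -> : u r - u t - (r - t)%:C *: u' t
    = (r - t)%:C *: ((r - t)^-1%:C *: (u r - u t) - u' t).
  by rewrite scalerBr scalerA -rmorphM mulfV// scale1r.
by rewrite cnormZR mulrC ler_wpM2r// ltW.
Qed.

Lemma deriv_on_slope u u' (M t e : R) : deriv_on T u u' -> 0 <= t <= T -> 0 < e ->
  cnorm (u' t) <= M ->
  \forall r \near t, 0 <= r <= T ->
    cnorm (u r - u t) <= (M + e) * `|r - t|.
Proof.
move=> du tT e0 uM; apply: filterS (deriv_on_taylor du tT e0) => r H rT.
rewrite (le_trans (cnorm_le_distD _ ((r - t)%:C *: u' t)))//.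
by rewrite addrC mulrDl lerD ?H// cnormZR mulrC ler_wpM2r.
Qed.

Lemma deriv_on_lipschitz u u' (M a b : R) : deriv_on T u u' ->
  (forall t, 0 <= t <= T -> cnorm (u' t) <= M) -> 0 <= a -> a <= b -> b <= T ->
  cnorm (u b - u a) <= M * (b - a).
Proof.
move=> du uM a0 ab bT; apply: mean_value_ineq => // t /andP[ta tb] e e0.
have tT : 0 <= t <= T by rewrite (le_trans a0)// (le_trans tb).
apply: filterS (deriv_on_slope du tT e0 (uM _ tT)) => r H /andP[ar rb].
by apply: H; rewrite (le_trans a0)// (le_trans rb).
Qed.

Lemma deriv_on_taylor2 u u' u'' (M a b : R) : deriv_on T u u' -> deriv_on T u' u'' ->
  (forall t, 0 <= t <= T -> cnorm (u'' t) <= M) -> 0 <= a -> a <= b -> b <= T ->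
  cnorm (u b - u a - (b - a)%:C *: u' a) <= M * (b - a) ^+ 2.
Proof.
move=> du du' uM a0 ab bT.
have M0 : 0 <= M.
  by rewrite (le_trans (cnorm_ge0 _) (uM a _))// a0 (le_trans ab).
(* The slope of [phi] at [t] is [u' t - u' a], bounded by [M (b - a)] since [u'] is Lipschitz. *)
pose phi r := u r - (r - a)%:C *: u' a.
have -> : u b - u a - (b - a)%:C *: u' a = phi b - phi a.
  by rewrite /phi (subrr a) scale0r subr0 addrAC.
rewrite expr2 mulrA; apply: mean_value_ineq => // t /andP[ta tb] e e0.
have tT : 0 <= t <= T by rewrite (le_trans a0)// (le_trans tb).
apply: filterS (deriv_on_taylor du tT e0) => r H /andP[ar rb].
have /H {}H : 0 <= r <= T by rewrite (le_trans a0)// (le_trans rb).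
have -> : phi r - phi t = (r - t)%:C *: (u' t - u' a)
    + (u r - u t - (r - t)%:C *: u' t).
  have E : r - a - (t - a) = r - t by rewrite opprB addrA subrK.
  by rewrite -E -affine_increment.
rewrite (le_trans (cnormD _ _))// mulrDl lerD//.
rewrite cnormZR mulrC ler_wpM2r//.
have /andP[_ tT'] := tT.
rewrite (le_trans (deriv_on_lipschitz du' uM a0 ta tT'))//.
by rewrite ler_wpM2l// lerD2r.
Qed.

(** Positivity of [T] makes every [t] an accumulation point of the interval. The lemma identifies
    the derivative given by the C^2 assumption with the right-hand side of the equation. *)
Lemma deriv_on_unique u u' u'' (t : R) : 0 < T -> deriv_on T u u' ->
  deriv_on T u u'' -> 0 <= t <= T -> u' t = u'' t.
Proof.
move=> T0 du du'' tT.
apply/eqP; rewrite -subr_eq0; apply/eqP/cnorm_eq0/eqP.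
rewrite eq_le cnorm_ge0 andbT; apply/ler_addgt0Pr => e e0; rewrite add0r.
have e20 : 0 < e / 2 by rewrite divr_gt0.
have /nbhs_ballP[d /= d0 H] : \forall r \near t, 0 <= r <= T ->
    cnorm (u r - u t - (r - t)%:C *: u' t) <= e / 2 * `|r - t| /\
    cnorm (u r - u t - (r - t)%:C *: u'' t) <= e / 2 * `|r - t|.
  near=> r => rT; split; move: rT; near: r; exact: deriv_on_taylor.
(* The point moves right from the first half of the interval and left from the second, by at most
   [T / 2], hence stays inside. *)
have [r [rT rt rd]] : exists r, [/\ 0 <= r <= T, r != t & `|r - t| < d].
  have [t0 tT'] := andP tT.
  have [tT2|Tt2] := leP t (T / 2).
    exists (t + Num.min (d / 2) (T / 2)); have m0 : 0 < Num.min (d / 2) (T / 2).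
      by rewrite lt_min !divr_gt0.
    have : Num.min (d / 2) (T / 2) <= d / 2 by rewrite ge_min lexx.
    have : Num.min (d / 2) (T / 2) <= T / 2 by rewrite ge_min lexx orbT.
    move: (Num.min _ _) m0 => m m0 mT md; split; [lra| |].
      by rewrite -subr_eq0 addrAC subrr add0r gt_eqF.
    by rewrite addrAC subrr add0r gtr0_norm//; lra.
  exists (t - Num.min (d / 2) (T / 2)); have m0 : 0 < Num.min (d / 2) (T / 2).
    by rewrite lt_min !divr_gt0.
  have : Num.min (d / 2) (T / 2) <= d / 2 by rewrite ge_min lexx.
  have : Num.min (d / 2) (T / 2) <= T / 2 by rewrite ge_min lexx orbT.
  move: (Num.min _ _) m0 => m m0 mT md; split; [lra| |].
    by rewrite -subr_eq0 addrAC subrr add0r oppr_eq0 gt_eqF.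
  by rewrite addrAC subrr add0r normrN gtr0_norm//; lra.
have /H /(_ rT)[h1 h2] : ball t d r by rewrite /ball/= distrC.
have rt0 : 0 < `|r - t| by rewrite normr_gt0 subr_eq0.
rewrite -(ler_pM2l rt0) -cnormZR scalerBr.
rewrite (le_trans (cnorm_dist (u r - u t) _ _))// cnormB mulrC [e in leRHS]splitr.
by rewrite mulrDl lerD.
Unshelve. all: by end_near. Qed.

End DerivOn.

(** * Lipschitz bounds for the nonlinearity *)

Section C1Lipschitz.
Context (R : realType) (T : R) (V W : normedModType R[i]).
Variables (f ft : R -> V -> W) (fx : R -> V -> V -> W).
Hypothesis f_C1 : C1_with T f ft fx.

Lemma C1_fxZ (t : R) x (r : R) v : 0 <= t <= T ->
  fx t x (r%:C *: v) = r%:C *: fx t x v.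
Proof.
move=> tT; have [[lin _] _ _ _] := f_C1 x tT.
have fx0 : fx t x 0 = 0.
  have := lin 1 0 0; rewrite !scale1r addr0 => /eqP.
  by rewrite -subr_eq0 opprD addrA subrr add0r oppr_eq0 => /eqP.
by have := lin r v 0; rewrite !addr0 fx0 addr0.
Qed.

Lemma C1_fx_opnorm_le (t : R) x (L : R) v : 0 <= t <= T -> (opnorm (fx t x) <= L%:E)%E ->
  cnorm (fx t x v) <= L * cnorm v.
Proof. by move=> tT; apply: opnorm_le => r w; exact: C1_fxZ. Qed.

Lemma near_graph (u : R -> V) (t : R) (Q : R * V -> Prop) : 0 <= t <= T ->
  u @ within `[0, T] (nbhs t) --> u t ->
  (\forall p \near (t, u t), Q p) ->
  \forall r \near t, 0 <= r <= T -> Q (r, u r).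
Proof.
move=> tT ut HQ.
have c1 : (fun r : R => r) @ within `[0, T] (nbhs t) --> t.
  exact: cvg_within.
have c2 : (fun r : R => (r, u r)) @ within `[0, T] (nbhs t) --> (t, u t).
  exact: (@cvg_pair _ _ _ _ (nbhs t) (nbhs (u t))).
have : \forall r \near within `[0, T] (nbhs t), Q (r, u r) := c2 _ HQ.
rewrite near_withinE; apply: filterS => r H rT.
by apply: H; rewrite /= in_itv.
Qed.

Lemma C1_local_bound (t : R) (x : V) : 0 <= t <= T ->
  exists M, \forall p \near (t, x), 0 <= p.1 <= T ->
    cnorm (ft p.1 p.2) <= M /\ forall v, cnorm (fx p.1 p.2 v) <= M * cnorm v.
Proof.
move=> tT; have [[_ fx_lt] _ ft_c fx_c] := f_C1 x tT.
have [L fxL] : exists L : R, (opnorm (fx t x) <= L%:E)%E.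
  move: fx_lt; case: (opnorm _) => [L _|//|_]; first by exists L.
  by exists 0; rewrite leNye.
(* By continuity both partial derivatives change by at most 1 near [(t, x)]. *)
exists (Num.max (cnorm (ft t x) + 1) (L + 1)).
apply: filterS (filterI (ft_c _ ltr01) (fx_c _ ltr01)) => p [H1 H2] pT.
split; first by rewrite le_max (le_trans (cnorm_le_distD _ (ft t x)))// addrC lerD2l H1.
move=> v; apply: (@le_trans _ _ ((L + 1) * cnorm v)); last first.
  by rewrite ler_wpM2r ?cnorm_ge0// le_max lexx orbT.
rewrite (le_trans (cnorm_le_distD _ (fx t x v)))// mulrDl addrC lerD//.
  exact: C1_fx_opnorm_le.
have lin z y (r : R) w : 0 <= z <= T -> fx z y (r%:C *: w) = r%:C *: fx z y w.
  by move=> zT; exact: C1_fxZ.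
apply: (@opnorm_le _ _ _ (fun v => fx p.1 p.2 v - fx t x v)).
  by move=> r w; rewrite !lin// scalerBr.
exact: H2.
Qed.

(* The slopes of [r |-> f r (u r)] are at most [(1 + M) K], with [K] a local bound
   of the partial derivatives along the graph of [u], and compactness makes [K]
   uniform. *)
Lemma C1_comp_lipschitz (u : R -> V) (M : R) :
  (forall a b, 0 <= a -> a <= b -> b <= T -> cnorm (u b - u a) <= M * (b - a)) ->
  exists K, forall a b, 0 <= a -> a <= b -> b <= T ->
    cnorm (f b (u b) - f a (u a)) <= K * (b - a).
Proof.
move=> uM.
have uM' r t : 0 <= r <= T -> 0 <= t <= T -> cnorm (u r - u t) <= M * `|r - t|.
  move=> /andP[r0 rT] /andP[t0 tT]; have [tr|rt] := leP t r.
    by rewrite ger0_norm ?subr_ge0// uM.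
  by rewrite cnormB distrC ger0_norm ?subr_ge0 ?uM// ltW.
have uc t : 0 <= t <= T -> u @ within `[0, T] (nbhs t) --> u t.
  move=> tT; apply: cvg_cnorm_lt => e e0; rewrite near_withinE.
  have c0 : 0 < `|M| + 1 by rewrite ltr_wpDl.
  apply/nbhs_ballP; exists (e / (`|M| + 1)) => /=; first by rewrite divr_gt0.
  move=> r; rewrite /ball/= distrC ltr_pdivlMr// => H rT.
  have {}rT : 0 <= r <= T by move: rT; rewrite /= in_itv.
  rewrite (le_lt_trans (uM' _ _ rT tT))// (le_lt_trans _ H)// mulrC ler_wpM2l//.
  by rewrite (le_trans (ler_norm _))// lerDl.
pose P (K t : R) := 0 <= K /\ forall e : R, 0 < e -> \forall r \near t, 0 <= r <= T ->
  cnorm (f r (u r) - f t (u t)) <= (K + e) * `|r - t|.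
have [K KP] : exists K, forall t, 0 <= t <= T -> P K t.
  apply: locally_bounded_segment.
    move=> K K' t KK' [K0 H]; split; first exact: le_trans KK'.
    move=> e /H; apply: filterS => r {}H /H /le_trans; apply.
    by rewrite ler_wpM2r// lerD2r.
  move=> t tT; have [L HL] := C1_local_bound (u t) tT.
  (* Chain rule: the time derivative contributes [|L|], and the space derivative [|L|] times the
     Lipschitz constant of [u]. *)
  exists (`|L| * (1 + `|M|)).
  have := near_graph tT (uc _ tT) HL; apply: filterS => r H rT.
  have /= [H1 H2] := H rT rT.
  split; first by rewrite mulr_ge0// addr_ge0.
  move=> e e0; have [_ fd _ _] := f_C1 (u r) rT.
  have c0 : 0 < 1 + `|M| by rewrite ltr_pwDl.
  (* The remainder is measured by the larger of the increments of time and of [u], at most [1 + |M|]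
     times the time increment. *)
  have /fd {}fd := divr_gt0 e0 c0.
  have := near_graph rT (uc _ rT) fd; apply: filterS => r' {}fd r'T.
  have /= {}fd := fd r'T r'T.
  have uM2 : cnorm (u r' - u r) <= `|M| * `|r' - r|.
    by rewrite (le_trans (uM' _ _ r'T rT))// ler_wpM2r// ler_norm.
  rewrite (le_trans (cnorm_le_distD _ ((r' - r)%:C *: ft r (u r)
    + fx r (u r) (u r' - u r))))// addrC mulrDl lerD//.
    rewrite (le_trans (cnormD _ _))// cnormZR -mulrA mulrDl mul1r mulrDr lerD//.
      by rewrite mulrC ler_wpM2r// (le_trans H1)// ler_norm.
    rewrite (le_trans (H2 _))// (@le_trans _ _ (`|L| * cnorm (u r' - u r)))//.
      by rewrite ler_wpM2r ?cnorm_ge0// ler_norm.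
    by rewrite ler_wpM2l.
  rewrite (le_trans fd)// -[e in leRHS](divfK (lt0r_neq0 c0)) -[leRHS]mulrA.
  rewrite ler_wpM2l ?divr_ge0 ?(ltW e0) ?(ltW c0)// ge_max; apply/andP; split.
    by rewrite -[leLHS]mul1r ler_wpM2r// lerDl.
  by rewrite (le_trans uM2)// ler_wpM2r// lerDr.
exists K => a b a0 ab bT; apply: (mean_value_ineq (phi := fun r => f r (u r))) => //.
move=> t /andP[ta tb] e e0.
have [|K0 /(_ _ e0)] := KP t; first by rewrite (le_trans a0)// (le_trans tb).
apply: filterS => r H /andP[ra rb].
by apply: H; rewrite (le_trans a0)// (le_trans rb).
Qed.

(** Mean value inequality along the segment from [x] to [y], which stays in the ball by
    convexity. *)
Lemma C1_lipschitz_ball (t : R) (x y : V) (delta L : R) : 0 <= t <= T ->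
  (forall v, cnorm (v - x) <= delta -> (opnorm (fx t v) <= L%:E)%E) ->
  cnorm (y - x) <= delta ->
  cnorm (f t y - f t x) <= L * cnorm (y - x).
Proof.
move=> tT fxL yx; pose z (r : R) : V := x + r%:C *: (y - x).
have zE a b : z b - z a = (b - a)%:C *: (y - x).
  by rewrite /z opprD addrACA subrr add0r rmorphB/= scalerBl.
have z0 : z 0 = x by rewrite /z scale0r addr0.
have z1 : z 1 = y by rewrite /z scale1r addrC subrK.
have := @mean_value_ineq R W 0 1 (L * cnorm (y - x)) (fun r => f t (z r)) ler01.
rewrite subr0 mulr1 z1 z0; apply.
move=> r /andP[r0 r1] e e0.
have c0 : 0 < cnorm (y - x) + 1 by rewrite ltr_wpDl// cnorm_ge0.
have [_ /(_ _ (divr_gt0 e0 c0)) fd _ _] := f_C1 (z r) tT.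
have zc : z @ r --> z r.
  apply: cvg_cnorm_lt => e' e'0; apply/nbhs_ballP.
  exists (e' / (cnorm (y - x) + 1)) => /=; first by rewrite divr_gt0.
  move=> r'; rewrite /ball/= distrC ltr_pdivlMr// zE cnormZR => H.
  by rewrite (le_lt_trans _ H)// ler_wpM2l// lerDl.
have c2 : (fun r' : R => (t, z r')) @ r --> (t, z r).
  by apply: (@cvg_pair _ _ _ _ (nbhs t) (nbhs (z r))) => //; exact: cvg_cst.
have {}fd : \forall r' \near r, 0 <= t <= T -> _ := c2 _ fd.
apply: filterS fd => r' {}fd _.
have /= := fd tT; rewrite subrr scale0r add0r normr0 zE => {}fd.
rewrite (le_trans (cnorm_le_distD _ (fx t (z r) ((r' - r)%:C *: (y - x)))))//.
rewrite addrC mulrDl lerD//.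
  rewrite -mulrA [cnorm _ * _]mulrC -cnormZR; apply: C1_fx_opnorm_le => //.
  apply: fxL; rewrite /z addrAC subrr add0r cnormZR ger0_norm//.
  by rewrite (le_trans _ yx)// ler_piMl ?cnorm_ge0.
rewrite (le_trans fd)// cnormZR -[e in leRHS](divfK (lt0r_neq0 c0)) -[leRHS]mulrA.
rewrite ler_wpM2l ?divr_ge0 ?(ltW e0) ?(ltW c0)// ge_max; apply/andP; split.
  by rewrite mulr_ge0// (ltW c0).
by rewrite mulrC ler_wpM2r// lerDl.
Qed.

End C1Lipschitz.

(** * The Lawson scheme *)

Section LawsonCombination.
Context (R : realType) (N : nat) (B : 'M[R[i]]_N).
Local Notation E t := (expmx ((t : R)%:C *: B)).
Hypothesis contraction :
  forall t (v : 'cV[R[i]]_N), 0 <= t -> cnorm (E t *m v) <= cnorm v.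
Variables (I : finType) (P : pred I) (a c : I -> R) (F : I -> 'cV[R[i]]_N).
Variables (w : 'cV[R[i]]_N) (k MF : R).
Hypothesis k_ge0 : 0 <= k.
Hypothesis F_le : forall j, P j -> cnorm (F j) <= MF.

(** Common form of the stages ([c0] equal to [c i]) and of the final update ([c0 = 1]). *)
Lemma lawson_combination_le (c0 : R) : 0 <= c0 ->
  (forall j, P j -> a j != 0 -> c j <= c0) ->
  cnorm (E (c0 * k) *m w +
    k%:C *: \sum_(j | P j) (a j)%:C *: (E ((c0 - c j) * k) *m F j) - w)
  <= k * (c0 * cnorm (B *m w) + (\sum_(j | P j) `|a j|) * MF).
Proof.
move=> c00 cc0; rewrite addrAC (le_trans (cnormD _ _))// mulrDr lerD//.
  rewrite mulrCA mulrA; apply: expmx_sub_le => //; exact: mulr_ge0.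
rewrite cnorm_mxZ ger0_norm// ler_wpM2l//.
rewrite (le_trans (cnorm_sum _ _ _))// mulr_suml; apply: ler_sum => j Pj.
(* Terms with zero coefficient are dropped first: only for the others is the exponent known to be
   nonnegative. *)
rewrite cnorm_mxZ; have [->|aj0] := eqVneq (a j) 0; first by rewrite normr0 !mul0r.
rewrite ler_wpM2l// (le_trans _ (F_le Pj))//; apply: contraction.
by rewrite mulr_ge0// subr_ge0 cc0.
Qed.

Hypothesis B_unit : B \in unitmx.

(** After applying the inverse, each exponential in the sum may be replaced by the identity at cost
    [k], and the sum carries another factor [k]. *)
Lemma invmx_lawson_combination_le : (forall j, P j -> 0 <= c j <= 1) ->
  cnorm (invmx B *m (E k *m w +
      k%:C *: \sum_(j | P j) (a j)%:C *: (E ((1 - c j) * k) *m F j) - w)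
    - k%:C *: (w + \sum_(j | P j) (a j)%:C *: (invmx B *m F j)))
  <= k ^+ 2 * (cnorm (B *m w) + (\sum_(j | P j) `|a j|) * MF).
Proof.
move=> c01.
rewrite addrAC mulmxDr scalerDr opprD addrACA (le_trans (cnormD _ _))//.
rewrite mulrDr lerD//; first exact: invmx_expmx_sub2_le.
rewrite -scalemxAr -scalerBr cnorm_mxZ ger0_norm// expr2 -mulrA ler_wpM2l//.
rewrite mulmx_sumr -sumrB (le_trans (cnorm_sum _ _ _))//.
rewrite mulr_suml mulr_sumr; apply: ler_sum => j Pj.
rewrite -scalemxAr -scalerBr -mulmxBr cnorm_mxZ mulrCA ler_wpM2l//.
have /andP[cj0 cj1] := c01 _ Pj.
have s0 : 0 <= (1 - c j) * k by rewrite mulr_ge0// subr_ge0.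
rewrite (le_trans (invmx_expmx_sub_le contraction B_unit _ s0))//.
by rewrite ler_pM ?cnorm_ge0 ?F_le// ler_piMl// gerBl.
Qed.

End LawsonCombination.

Section GridValues.
Context (R : realType) (d : nat) (Omega : bounded_domain R d).
Context (Y : completeNormedModType R[i]) (D : space_disc Omega Y).
Local Notation Pr := (@sd_P R d Omega Y D).

Lemma sd_PB x y : Pr (x - y) = Pr x - Pr y.
Proof. by apply/matrixP => i j; rewrite !mxE. Qed.

Lemma sd_PD x y : Pr (x + y) = Pr x + Pr y.
Proof. by apply/matrixP => i j; rewrite !mxE. Qed.

Lemma sd_PZ a x : Pr (a *: x) = a *: Pr x.
Proof. by apply/matrixP => i j; rewrite !mxE. Qed.

Lemma cnorm_sd_P x : cnorm (Pr x) <= cnorm x.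
Proof.
apply: cnorm_mx_le => [|i j]; first exact: cnorm_ge0.
by rewrite mxE contfun_cnormE; have [y _ [-> ->]] := maxnorm_max x.
Qed.

End GridValues.

(* [x] and [y] are the increments of the numerical and of the exact solution after
   multiplication by the inverse of the discrete operator; only the last term, the
   error of the elliptic projection, is not O(k^2). *)
Lemma consistency_splitting (R : realType) n (a : R[i])
    (x y w v G q : 'cV[R[i]]_n) :
  x - y = (x - a *: (w + v)) + a *: (v - G) - (y - a *: (q + G)) + a *: (w - q).
Proof. by apply/matrixP => i j; rewrite !mxE; ring. Qed.

(** * Local error on one grid, with explicit constants *)

Section LocalError.
Context (R : realType) (d : nat) (Omega : bounded_domain R d).
Context (Y : completeNormedModType R[i]) (D : space_disc Omega Y).
Context (s : nat) (tab : tableau R s) (T : R) (f : R -> contfun Omega -> contfun Omega).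
Context (u : R -> contfun Omega) (g : R -> Y).
Local Notation Pr := (@sd_P R d Omega Y D).
Local Notation B := (sd_A D).
Local Notation a := (rk_a tab).
Local Notation b := (rk_b tab).
Local Notation c := (rk_c tab).
Variables (delta L MB MF0 KF Lu : R).
Hypothesis contraction : forall t (v : 'cV[R[i]]_(sd_dim D)), 0 <= t ->
  cnorm (expmx (t%:C *: B) *m v) <= cnorm v.
Hypothesis tab_forward : forward_tableau tab.
Hypothesis g0 : forall t, 0 <= t <= T -> g t = 0.
Hypothesis BPu_le : forall t, 0 <= t <= T -> cnorm (B *m Pr (u t)) <= MB.
Hypothesis sd_f_lip : forall t v, 0 <= t <= T -> cnorm (v - Pr (u t)) <= delta ->
  cnorm (@sd_f _ _ _ _ D t v - Pr (f t (u t))) <= L * cnorm (v - Pr (u t)).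
Hypothesis f_le : forall t, 0 <= t <= T -> cnorm (f t (u t)) <= MF0.
Hypothesis f_lip : forall t r, 0 <= t -> t <= r -> r <= T ->
  cnorm (f r (u r) - f t (u t)) <= KF * (r - t).
Hypothesis u_lip : forall t r, 0 <= t -> t <= r -> r <= T ->
  cnorm (u r - u t) <= Lu * (r - t).
Hypotheses (L_ge0 : 0 <= L) (KF_ge0 : 0 <= KF) (Lu_ge0 : 0 <= Lu).
Variables (k : R) (n : nat).
Hypotheses (k_gt0 : 0 < k) (kT : n.+1%:R * k <= T).
Local Notation t := (n%:R * k).
Hypothesis stay : forall i,
  cnorm (lawson_stage tab D g u k n i - Pr (u (t + c i * k))) <= delta.
Local Notation rhs := (lawson_rhs tab g k n (lawson_stage tab D g u k n)).

(** [MF] bounds the right-hand side at every stage lying in the tube; [CK] is the constant of the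
    O(k) stage error. *)
Let MF := L * delta + MF0.
Let Sa := \sum_(i < s) \sum_(j < s) `|a i j|.
Let Sb := \sum_(i < s) `|b i|.
Let CK := MB + Sa * MF + Lu.

Let t_ge0 : 0 <= t. Proof. by rewrite mulr_ge0// ltW. Qed.
Let tkE : n.+1%:R * k = t + k. Proof. by rewrite -natr1 mulrDl mul1r. Qed.
Let stage_time i : t <= t + c i * k <= t + k.
Proof.
have [/(_ i)/andP[c0 c1] _] := tab_forward.
by rewrite lerDl lerD2l mulr_ge0 ?ler_piMl// ltW.
Qed.
Let stage_time_in i : 0 <= t + c i * k <= T.
Proof.
have /andP[h1 h2] := stage_time i.
by rewrite (le_trans t_ge0 h1) (le_trans h2)// -tkE.
Qed.
Let t_in : 0 <= t <= T.
Proof. by rewrite t_ge0 (le_trans _ kT)// tkE lerDl ltW. Qed.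

(** The boundary term vanishes because [g] does, and [stay] places the stage where the Lipschitz
    bound of the discrete nonlinearity holds. *)
Lemma lawson_rhs_sub_le i :
  cnorm (rhs i - Pr (f (t + c i * k) (u (t + c i * k))))
  <= L * cnorm (lawson_stage tab D g u k n i - Pr (u (t + c i * k))).
Proof.
by rewrite /lawson_rhs g0// raddf0 add0r sd_f_lip.
Qed.

Lemma lawson_rhs_le i : cnorm (rhs i) <= MF.
Proof.
rewrite (le_trans (cnorm_le_distD _ (Pr (f (t + c i * k) (u (t + c i * k))))))//.
rewrite lerD//.
  by rewrite (le_trans (lawson_rhs_sub_le i))// ler_wpM2l.
by rewrite (le_trans (cnorm_sd_P _ _))// f_le.
Qed.

Let MB_ge0 : 0 <= MB.
Proof. exact: le_trans (cnorm_ge0 _) (BPu_le t_in). Qed.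

Lemma lawson_stage_sub_le i :
  cnorm (lawson_stage tab D g u k n i - Pr (u (t + c i * k))) <= CK * k.
Proof.
have [c01 ac] := tab_forward; have /andP[ci0 ci1] := c01 i.
have MF_ge0 : 0 <= MF := le_trans (cnorm_ge0 _) (lawson_rhs_le i).
rewrite (le_trans (cnorm_dist (Pr (u t)) _ _))// mulrDl lerD//.
  rewrite lawson_stageE.
  apply: le_trans (@lawson_combination_le _ _ _ contraction _
    (fun j : 'I_s => (j < i)%N) (a i) c rhs (Pr (u t)) k MF (ltW k_gt0)
    (fun j _ => lawson_rhs_le j) _ ci0 (ac i)) _.
  rewrite mulrC ler_wpM2r ?(ltW k_gt0)// lerD//.
    by rewrite (le_trans _ (BPu_le t_in))// ler_piMl// cnorm_ge0.
  (* The part of row [i] below the diagonal is dominated by the full double sum, which makes the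
     constant independent of [i]. *)
  rewrite ler_wpM2r// /Sa [leRHS](bigD1 i)//= ler_wpDr//.
    by apply: sumr_ge0 => l _; apply: sumr_ge0.
  by rewrite big_mkcond/=; apply: ler_sum => j _; case: ifP.
rewrite cnormB -sd_PB (le_trans (cnorm_sd_P _ _))//.
have /andP[h1 h2] := stage_time i.
rewrite (le_trans (u_lip t_ge0 h1 _))//; first by rewrite (le_trans h2)// -tkE.
by rewrite addrAC subrr add0r ler_wpM2l// ler_piMl// ltW.
Qed.

Lemma lawson_step_sub_le :
  cnorm (lawson_step tab D g u k n - Pr (u t)) <= (MB + Sb * MF) * k.
Proof.
have [c01 _] := tab_forward.
have := @lawson_combination_le _ _ _ contraction _ predT b c rhs (Pr (u t)) k MF
  (ltW k_gt0) (fun j _ => lawson_rhs_le j) 1 ler01.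
rewrite !mul1r => H; rewrite (le_trans (H _))//.
  by move=> j _ _; have /andP[] := c01 j.
by rewrite mulrC ler_wpM2r ?(ltW k_gt0)// lerD2r BPu_le.
Qed.

Lemma local_error_le :
  cnorm (local_error tab D g u k n) <= (MB + Sb * MF + Lu) * k.
Proof.
rewrite /local_error (le_trans (cnorm_dist (Pr (u t)) _ _))// mulrDl lerD//.
  exact: lawson_step_sub_le.
rewrite cnormB -sd_PB (le_trans (cnorm_sd_P _ _))//.
have h : t <= n.+1%:R * k by rewrite tkE lerDl ltW.
by rewrite (le_trans (u_lip t_ge0 h kT))// tkE addrAC subrr add0r.
Qed.

Hypothesis B_unit : B \in unitmx.
Variables (CI M2 : R) (u1 q : contfun Omega).
Hypothesis CI_ge0 : 0 <= CI.
Hypothesis invB_le : forall v : 'cV[R[i]]_(sd_dim D),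
  cnorm (invmx B *m v) <= CI * cnorm v.
Hypothesis u_taylor : cnorm (u (t + k) - u t - k%:C *: u1) <= M2 * k ^+ 2.
Hypothesis u1E : u1 = q + f t (u t).
Hypothesis sum_b : \sum_(i < s) b i = 1.

(** Here [u1] is the derivative of [u] and [q] is [A u], both at [t]. The coefficient of [k ^+ 2]
    collects the replaced exponentials, the variation of the nonlinearity over the stages and the
    Taylor remainder of [u]. *)
Lemma invmx_local_error_le :
  cnorm (invmx B *m local_error tab D g u k n)
  <= k * cnorm (Pr (u t) - invmx B *m Pr q) +
     (MB + Sb * MF + Sb * (CI * (L * CK + KF)) + CI * M2) * k ^+ 2.
Proof.
have [c01 _] := tab_forward; have k_ge0 := ltW k_gt0.
pose G := Pr (f t (u t)).
pose S := \sum_(i < s) (b i)%:C *: (invmx B *m rhs i).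
have -> : local_error tab D g u k n =
  (lawson_step tab D g u k n - Pr (u t)) - (Pr (u (t + k)) - Pr (u t)).
  by rewrite opprB addrA subrK /local_error tkE.
rewrite mulmxBr.
rewrite (consistency_splitting k%:C (invmx B *m (lawson_step tab D g u k n - Pr (u t)))
  (invmx B *m (Pr (u (t + k)) - Pr (u t))) (Pr (u t)) S (invmx B *m G)
  (invmx B *m Pr q)).
rewrite (le_trans (cnormD _ _))// [leLHS]addrC lerD//.
  by rewrite cnorm_mxZ ger0_norm.
rewrite mulrDl (le_trans (cnormD _ _))// cnormN lerD//; last first.
  rewrite -mulmxDr -sd_PD -u1E -sd_PB scalemxAr -sd_PZ -mulmxBr -sd_PB.
  rewrite (le_trans (invB_le _))// -mulrA ler_wpM2l//.
  exact: le_trans (cnorm_sd_P _ _) u_taylor.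
rewrite mulrDl (le_trans (cnormD _ _))// lerD//.
  have := @invmx_lawson_combination_le _ _ _ contraction _ predT b c rhs (Pr (u t))
    k MF k_ge0 (fun j _ => lawson_rhs_le j) B_unit (fun j _ => c01 j).
  move=> /le_trans; apply.
  by rewrite mulrC ler_wpM2r ?exprn_ge0// lerD2r BPu_le.
rewrite cnorm_mxZ ger0_norm// expr2 mulrA [leRHS]mulrC ler_wpM2l//.
(* Since the weights sum to 1, [G] can be distributed over the stages. *)
have -> : S - invmx B *m G = \sum_(i < s) (b i)%:C *: (invmx B *m (rhs i - G)).
  rewrite -[invmx B *m G]scale1r -(rmorph1 (real_complex R)) -sum_b rmorph_sum/=.
  rewrite scaler_suml -sumrB; apply: eq_bigr => i _.
  by rewrite mulmxBr scalerBr.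
rewrite (le_trans (cnorm_sum _ _ _))// -mulrA mulr_suml; apply: ler_sum => i _.
rewrite cnorm_mxZ ler_wpM2l// (le_trans (invB_le _))// -mulrA ler_wpM2l//.
have /andP[ci0 ci1] := c01 i.
(* The exact nonlinearity at the stage time is inserted: one difference is the stage error, the
   other the drift of [f] along [u]. *)
rewrite (le_trans (cnorm_dist (Pr (f (t + c i * k) (u (t + c i * k)))) _ _))//.
rewrite mulrDl lerD//.
  rewrite (le_trans (lawson_rhs_sub_le i))// -mulrA ler_wpM2l//.
  exact: lawson_stage_sub_le.
rewrite -sd_PB (le_trans (cnorm_sd_P _ _))//.
have /andP[h1 h2] := stage_time i.
rewrite (le_trans (f_lip t_ge0 h1 _))//; first by rewrite (le_trans h2)// -tkE.
by rewrite addrAC subrr add0r ler_wpM2l// ler_piMl.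
Qed.

End LocalError.

(** Merges the projection error and the quadratic terms under one constant; absolute values are
    taken as [M] and [K] have no prescribed sign. *)
Lemma ler_combine_orders (R : realDomainType) (x y k K e M : R) :
  0 <= k -> 0 <= e -> y <= e * M -> x <= k * y + K * k ^+ 2 ->
  x <= (`|M| + `|K|) * (e * k + k ^+ 2).
Proof.
move=> k0 e0 yM /le_trans; apply.
rewrite mulrDl lerD//.
  rewrite mulrC (le_trans (ler_wpM2r k0 yM))//.
  rewrite (@le_trans _ _ (`|M| * (e * k)))//; last first.
    by rewrite ler_wpM2l// lerDl exprn_ge0.
  by rewrite mulrAC mulrC ler_wpM2r ?mulr_ge0// ler_norm.
rewrite (@le_trans _ _ (`|K| * k ^+ 2))//.
  by rewrite ler_wpM2r ?exprn_ge0// ler_norm.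
by rewrite ler_wpM2l// lerDr mulr_ge0.
Qed.

(** * Uniform constants and conclusion *)

Unset Implicit Arguments.

Theorem theorem2 (R : realType) (d : nat) (Omega : bounded_domain R d)
    (Y : completeNormedModType R[i])
    (T : R) (DA : set (contfun Omega)) (A : contfun Omega -> contfun Omega)
    (bd : contfun Omega -> Y) (S : R -> {linear contfun Omega -> contfun Omega})
    (omega : R) (f : R -> contfun Omega -> contfun Omega) (g : R -> Y)
    (u0 : contfun Omega) (u : R -> contfun Omega)
    (Z : set (contfun Omega)) (nZ : contfun Omega -> R)
    (H : set R) (disc : R -> space_disc Omega Y) (eps eta : R -> R)
    (delta L : R) (s : nat) (tab : tableau R s) (kmax : R)
    (Hcont : continuous_problem T DA A bd S omega f g u0 u)
    (Hdisc : discretization T DA A bd S f u Z nZ H disc eps eta delta L)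
    (Htab : forward_tableau tab)
    (Hstay : stages_stay T g u H disc delta tab kmax)
    (Hu_Z : forall t, 0 <= t <= T -> Z (u t))
    (Hu_Z_cont : forall t, 0 <= t <= T -> forall e, 0 < e ->
      \forall r \near t, 0 <= r <= T -> nZ (u r - u t) < e)
    (Hbd0 : forall t, 0 <= t <= T -> bd (u t) = 0) :
  (exists C : R, \forall h \near within H 0^'+,
     forall (k : R) (n : nat), 0 < k <= kmax -> n.+1%:R * k <= T ->
       cnorm (local_error tab (disc h) g u k n) <= C * k) /\
  (\sum_(i < s) rk_b tab i = 1 -> Cn_on T 2 u ->
   exists C : R, \forall h \near within H 0^'+,
     forall (k : R) (n : nat), 0 < k <= kmax -> n.+1%:R * k <= T ->
       cnorm (invmx (sd_A (disc h)) *m local_error tab (disc h) g u k n)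
       <= C * (eta h * k + k ^+ 2)).
Proof.
have T0 := cp_time Hcont.
have du := cp_equation Hcont.
have gE t : 0 <= t <= T -> g t = 0.
  by move=> tT; rewrite -(cp_boundary Hcont tT) Hbd0.
have T_in : 0 <= (0 : R) <= T by rewrite lexx ltW.
have [Lu Lu0 u_lip] : exists2 Lu, 0 <= Lu & forall t r, 0 <= t -> t <= r ->
    r <= T -> cnorm (u r - u t) <= Lu * (r - t).
  have [u1 du1 /continuous_segment_bounded[M u1M]] := cp_u_C1 Hcont.
  exists M; first exact: le_trans (cnorm_ge0 _) (u1M _ T_in).
  by move=> t r; exact: deriv_on_lipschitz du1 u1M.
have [KF KF0 f_lip] : exists2 KF, 0 <= KF & forall t r, 0 <= t -> t <= r ->
    r <= T -> cnorm (f r (u r) - f t (u t)) <= KF * (r - t).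
  have [ft [fx /C1_comp_lipschitz fC1]] := cp_f_C1 Hcont.
  have [K KP] := fC1 u Lu u_lip.
  exists `|K| => // t r t0 tr rT; rewrite (le_trans (KP _ _ t0 tr rT))//.
  by rewrite ler_wpM2r ?subr_ge0// ler_norm.
have f_le t : 0 <= t <= T -> cnorm (f t (u t)) <= cnorm (f 0 (u 0)) + KF * T.
  move=> /andP[t0 tT]; rewrite (le_trans (cnorm_le_distD _ (f 0 (u 0))))//.
  rewrite addrC lerD2l (le_trans (f_lip _ _ (lexx 0) t0 tT))//.
  by rewrite subr0 ler_wpM2l.
have [MA Au_le] := continuous_segment_bounded (cp_Au_cont Hcont).
(* Continuity into [Z], with tolerance 1, bounds the [Z]-norm locally along [u]; compactness makes
   the bound global. *)
have [MZ uZ_le] : exists MZ, forall t, 0 <= t <= T -> nZ (u t) <= MZ.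
  apply: (@locally_bounded_segment _ _ _ (fun M t => nZ (u t) <= M)).
    by move=> M M' t MM' /le_trans; apply.
  move=> t tT; exists (1 + nZ (u t)).
  apply: filterS (Hu_Z_cont t tT 1 ltr01) => r H1 rT.
  have [_ Zlin] := di_Z_subspace Hdisc; have [nZD _ _] := di_Z_norm Hdisc.
  have Zrt : Z (u r - u t).
    by rewrite addrC -scaleN1r; apply: Zlin; exact: Hu_Z.
  rewrite -{1}(subrK (u t) (u r)) (le_trans (nZD _ _ Zrt (Hu_Z t tT)))//.
  by rewrite lerD2r ltW// H1.
have [CI invB_le] := di_inv_bound Hdisc.
(* Restricting to [eps h <= 1] makes the bound [MB] below independent of [h]. *)
have near_H : \forall h \near within H 0^'+, H h /\ eps h <= 1.
  apply: filterI; first exact: withinT.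
  have := di_eps_small Hdisc => /cvgr_lt /(_ 1 ltr01).
  by apply: filterS => h /ltW.
have contraction h : H h -> forall t (v : 'cV[R[i]]_(sd_dim (disc h))), 0 <= t ->
    cnorm (expmx (t%:C *: sd_A (disc h)) *m v) <= cnorm v.
  move=> Hh t v t0; rewrite -[leRHS]mul1r; apply: opnorm_mulmx_le.
  exact: (di_contraction Hdisc Hh t0).
(* The homogeneous boundary condition removes the term with [sd_C] from the definition of the
   elliptic projection. *)
have AR h t : H h -> 0 <= t <= T ->
    sd_A (disc h) *m sd_R (disc h) (u t) = sd_P (disc h) (A (u t)).
  move=> Hh tT; rewrite -(di_R Hdisc Hh (cp_u_domain Hcont tT)) Hbd0//.
  by rewrite raddf0 addr0.
pose MB := `|MZ| + MA.
have BPu_le h : H h -> eps h <= 1 -> forall t, 0 <= t <= T ->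
    cnorm (sd_A (disc h) *m sd_P (disc h) (u t)) <= MB.
  move=> Hh eps1 t tT.
  rewrite (le_trans (cnorm_le_distD _ (sd_A (disc h) *m sd_R (disc h) (u t))))//.
  rewrite -mulmxBr lerD//.
    rewrite (le_trans (di_eps Hdisc Hh (Hu_Z t tT)))//.
    rewrite (@le_trans _ _ (eps h * `|MZ|))//.
      rewrite ler_wpM2l ?(di_eps_ge0 Hdisc Hh)// (le_trans (uZ_le _ tT))//.
      exact: ler_norm.
    by rewrite ler_piMl.
  by rewrite AR// (le_trans (cnorm_sd_P _ _))// Au_le.
have sd_f_lip h : H h -> forall t v, 0 <= t <= T ->
    cnorm (v - sd_P (disc h) (u t)) <= delta ->
    cnorm (@sd_f _ _ _ _ (disc h) t v - sd_P (disc h) (f t (u t)))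
    <= `|L| * cnorm (v - sd_P (disc h) (u t)).
  move=> Hh t v tT vu; have [ft [fx [fC1 fxL]]] := di_f_C1 Hdisc Hh.
  rewrite (di_f_grid Hdisc _ Hh tT).
  rewrite (le_trans (C1_lipschitz_ball fC1 tT (fun w => fxL t w tT) vu))//.
  by rewrite ler_wpM2r ?cnorm_ge0// ler_norm.
split.
  (* The constant is left open until the estimate is applied; being fixed before [h], [k] and [n],
     it cannot depend on them. *)
  eexists; apply: filterS near_H => h [Hh eps1] k n /andP[k0 kk] kT.
  apply: (local_error_le (contraction h Hh) Htab gE (BPu_le h Hh eps1)
    (sd_f_lip h Hh) f_le u_lip) => // i.
  by apply: Hstay; rewrite ?k0.
move=> sum_b [u1 du1 [u2 du2 /continuous_segment_bounded[M2 u2M]]].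
eexists; apply: filterS near_H => h [Hh eps1] k n /andP[k0 kk] kT.
set t := n%:R * k.
have tkE : n.+1%:R * k = t + k by rewrite -natr1 mulrDl mul1r.
have t0 : 0 <= t by rewrite mulr_ge0// ltW.
have tkT : t + k <= T by rewrite -tkE.
have ttk : t <= t + k by rewrite lerDl ltW.
have tT : 0 <= t <= T by rewrite t0 (le_trans ttk).
have u_taylor : cnorm (u (t + k) - u t - k%:C *: u1 t) <= M2 * k ^+ 2.
  have := deriv_on_taylor2 du1 du2 u2M t0 ttk tkT.
  by have -> : t + k - t = k by rewrite addrAC subrr add0r.
have u1E : u1 t = A (u t) + f t (u t) := deriv_on_unique T0 du1 du tT.
have invB_le' (v : 'cV[R[i]]_(sd_dim (disc h))) :
    cnorm (invmx (sd_A (disc h)) *m v) <= `|CI| * cnorm v.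
  rewrite (le_trans (opnorm_mulmx_le v (invB_le h Hh)))//.
  by rewrite ler_wpM2r ?cnorm_ge0// ler_norm.
(* By [AR] the second term is [sd_R (disc h) (u t)], so this is the elliptic projection error
   bounded by [eta h]. *)
have residual : cnorm (sd_P (disc h) (u t)
    - invmx (sd_A (disc h)) *m sd_P (disc h) (A (u t))) <= eta h * MZ.
  rewrite -AR// mulKmx ?(di_unit Hdisc Hh)//.
  rewrite (le_trans (di_eta Hdisc Hh (Hu_Z t tT)))//.
  by rewrite ler_wpM2l ?(di_eta_ge0 Hdisc Hh)// uZ_le.
apply: (ler_combine_orders (ltW k0) (di_eta_ge0 Hdisc Hh) residual).
apply: (@invmx_local_error_le _ _ _ _ (disc h) _ tab T f u g delta `|L| MB _ KF Lu
  (contraction h Hh) Htab gE (BPu_le h Hh eps1) (sd_f_lip h Hh) f_le f_lip u_lip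
  (normr_ge0 _) KF0 Lu0 k n k0 kT _ (di_unit Hdisc Hh) `|CI| M2 (u1 t) (A (u t))
  (normr_ge0 _) invB_le' u_taylor u1E sum_b) => i.
by apply: Hstay; rewrite ?k0.
Qed.
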